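(* Let $T>0$ and let $\overline u$ and $\underline u$ be, respectively, a supersolution and a subsolution in $Q_T$ of the problem $$u_t=\Delta u-c(x,t)u^p\ \ (x\in\Omega,\ t>0),\qquad \frac{\partial u(x,t)}{\partial\nu}=\int_{\Omega}k(x,y,t)u^l(y,t)\,dy\ \ (x\in\partial\Omega,\ t\ge0),\qquad u(x,0)=u_0(x)\ \ (x\in\Omega).$$ If $l<1$, suppose in addition that $\underline u(x,t)>0$ in $Q_T\cup\Gamma_T$ or $\overline u(x,t)>0$ in $Q_T\cup\Gamma_T$. Then $\overline u(x,t)\ge\underline u(x,t)$ in $Q_T\cup\Gamma_T$.
   Context: Standing assumptions: $n\ge 1$, $\Omega\subset\mathbb{R}^n$ is a bounded domain with smooth boundary $\partial\Omega$, $\nu$ is the unit outward normal on $\partial\Omega$; $p>0$, $l>0$; $c\in C^{\alpha}_{loc}(\overline\Omega\times[0,+\infty))$ with $0<\alpha<1$ (locally Hölder continuous) and $c(x,t)\ge 0$; $k\in C(\partial\Omega\times\overline\Omega\times[0,+\infty))$, $k(x,y,t)\ge 0$; $u_0\in C^1(\overline\Omega)$, $u_0\ge 0$ in $\Omega$, and $\frac{\partial u_0(x)}{\partial\nu}=\int_\Omega k(x,y,0)u_0^l(y)\,dy$ on $\partial\Omega$. Notation: for $T>0$, $Q_T=\Omega\times(0,T)$, $S_T=\partial\Omega\times(0,T)$, $\Gamma_T=S_T\cup(\overline\Omega\times\{0\})$. Definitions: a nonnegative function $u\in C^{2,1}(Q_T)\cap C^{1,0}(Q_T\cup\Gamma_T)$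 is a supersolution of the problem in $Q_T$ if $u_t\ge\Delta u-c(x,t)u^p$ for $(x,t)\in Q_T$, $\frac{\partial u(x,t)}{\partial\nu}\ge\int_\Omega k(x,y,t)u^l(y,t)\,dy$ for $x\in\partial\Omega$, $0\le t<T$, and $u(x,0)\ge u_0(x)$ for $x\in\Omega$. A nonnegative function $u\in C^{2,1}(Q_T)\cap C^{1,0}(Q_T\cup\Gamma_T)$ is a subsolution in $Q_T$ if it satisfies these three inequalities in the reverse order. *)

(* Defs.v *)
From HB Require Import structures.
From mathcomp Require Import all_boot all_order all_algebra.
From mathcomp Require Import all_classical all_reals all_analysis.

Set Implicit Arguments.
Unset Strict Implicit.
Unset Printing Implicit Defensive.

Import Order.TTheory GRing.Theory Num.Theory.
Import numFieldNormedType.Exports.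

Local Open Scope classical_set_scope.
Local Open Scope ring_scope.

Definition rV_display : measure_display.
Proof. exact: default_measure_display. Qed.

(* 'rV[R]_n carries the sigma-algebra generated by the coordinate maps *)
Section rV_measurable.
Context {R : realType}.
Variable n : nat.

Definition rV_coord (i : 'I_n) (x : 'rV[R]_n) : R := x ord0 i.

Let rV_set0 : g_sigma_preimage rV_coord set0.
Proof. exact: sigma_algebra0. Qed.

Let rV_setC A : g_sigma_preimage rV_coord A -> g_sigma_preimage rV_coord (~` A).
Proof. exact: sigma_algebraC. Qed.

Let rV_bigcup (F : (set 'rV[R]_n)^nat) :
  (forall i, g_sigma_preimage rV_coord (F i)) ->
  g_sigma_preimage rV_coord (\bigcup_i (F i)).
Proof. exact: sigma_algebra_bigcup. Qed.

HB.instance Definition _ := @isMeasurable.Build rV_display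
  'rV[R]_n (g_sigma_preimage rV_coord) rV_set0 rV_setC rV_bigcup.

End rV_measurable.

Lemma measurable_rV_coord (R : realType) n (i : 'I_n) :
  measurable_fun [set: 'rV[R]_n] (@rV_coord R n i).
Proof.
move=> _ Y mY; rewrite setTI; apply: sub_sigma_algebra => /=.
rewrite -bigcup_seq/=; exists i => /=; first by rewrite mem_index_enum.
by exists Y => //; rewrite setTI.
Qed.

Lemma measurable_fun_rVP d (T : measurableType d) (R : realType) n
    (f : T -> 'rV[R]_n) :
  (forall i, measurable_fun setT (fun x => f x ord0 i)) ->
  measurable_fun setT f.
Proof.
move=> mf _ A mA; rewrite setTI.
have sA : sigma_algebra setT [set B | d.-measurable (f @^-1` B)].
  split=> /=.
  - by rewrite preimage_set0.
  - by move=> B mB; rewrite setTD preimage_setC; exact: measurableC.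
  - by move=> F mF; rewrite preimage_bigcup; exact: bigcupT_measurable.
have := @smallest_sub _ (sigma_algebra setT)
  (\big[setU/set0]_(i < n) preimage_set_system setT (@rV_coord R n i) measurable)
  _ sA.
move=> /(_ _ A); apply; last exact: mA.
move=> B; rewrite -bigcup_seq => -[i /= _] [C mC <-]; rewrite setTI /=.
by rewrite -comp_preimage -[X in measurable X]setTI; exact: (mf i).
Qed.

Section row_cons.
Context {R : realType}.
Variable n : nat.

Definition row_cons (z : R * 'rV[R]_n) : 'rV[R]_n.+1 := row_mx z.1%:M z.2.
Definition row_uncons (x : 'rV[R]_n.+1) : R * 'rV[R]_n :=
  (x ord0 ord0, \row_j x ord0 (lift ord0 j)).

Lemma row_cons0 z : row_cons z ord0 ord0 = z.1.
Proof. by rewrite mxE; case: splitP => // j _; rewrite !ord1 mxE eqxx. Qed.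

Lemma row_consS z j : row_cons z ord0 (lift ord0 j) = z.2 ord0 j.
Proof.
rewrite mxE; case: splitP => [i|i [/ord_inj ->]//].
by rewrite ord1.
Qed.

Lemma row_consK : cancel row_cons row_uncons.
Proof.
move=> z; rewrite /row_uncons row_cons0 [RHS]surjective_pairing; congr pair.
by apply/rowP => j; rewrite mxE row_consS.
Qed.

Lemma row_unconsK : cancel row_uncons row_cons.
Proof.
move=> x; apply/rowP => i; have [j ->|->] := unliftP ord0 i.
  by rewrite row_consS mxE.
by rewrite row_cons0.
Qed.

Lemma measurable_row_cons : measurable_fun setT row_cons.
Proof.
apply: measurable_fun_rVP => i; have [j ->|->] := unliftP ord0 i.
  rewrite (_ : (fun _ => _) = @rV_coord R n j \o snd); last first.
    by apply/funext => z; rewrite row_consS.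
  exact: measurableT_comp (@measurable_rV_coord _ _ _) measurable_snd.
by rewrite (_ : (fun _ => _) = fst)//; apply/funext => z; rewrite row_cons0.
Qed.

Lemma measurable_row_uncons : measurable_fun setT row_uncons.
Proof.
apply/measurable_fun_pairP; split; first exact: measurable_rV_coord.
apply: measurable_fun_rVP => j.
rewrite (_ : (fun _ => _) = @rV_coord R n.+1 (lift ord0 j)).
  exact: measurable_rV_coord.
by apply/funext => x; rewrite /= mxE.
Qed.

End row_cons.

Section lebesgue_rV_step.
Context {R : realType}.
Variables (n : nat) (mu : {sigma_finite_measure set 'rV[R]_n -> \bar R}).
Local Open Scope ereal_scope.

Definition lebesgue_step : set 'rV[R]_n.+1 -> \bar R :=
  pushforward (@lebesgue_measure R \x mu) (@row_cons R n).

Let measurable_preimage_row_cons (A : set 'rV[R]_n.+1) :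
  measurable A -> measurable (@row_cons R n @^-1` A).
Proof.
by move=> mA; rewrite -[X in measurable X]setTI; exact: measurable_row_cons.
Qed.

Let lebesgue_step0 : lebesgue_step set0 = 0.
Proof. by rewrite /lebesgue_step /pushforward preimage_set0 measure0. Qed.

Let lebesgue_step_ge0 A : 0 <= lebesgue_step A.
Proof. exact: (measure_ge0 (@lebesgue_measure R \x mu)). Qed.

Let lebesgue_step_sigma_additive : semi_sigma_additive lebesgue_step.
Proof.
move=> F mF tF mUF; rewrite /lebesgue_step /pushforward preimage_bigcup.
apply: measure_semi_sigma_additive.
- by move=> k; exact: measurable_preimage_row_cons.
- apply/trivIsetP => /= i j _ _ ij; rewrite -preimage_setI.
  by move/trivIsetP : tF => /(_ _ _ _ _ ij) ->//; rewrite preimage_set0.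
- by rewrite -preimage_bigcup; exact: measurable_preimage_row_cons.
Qed.

HB.instance Definition _ := isMeasure.Build _ _ _ lebesgue_step
  lebesgue_step0 lebesgue_step_ge0 lebesgue_step_sigma_additive.

Let sigma_finite_lebesgue_step : sigma_finite setT lebesgue_step.
Proof.
have /sigma_finiteP[F [TF ndF Foo]] := sigma_finiteT (@lebesgue_measure R).
have /sigma_finiteP[G [TG ndG Goo]] := sigma_finiteT mu.
exists (fun k => @row_uncons R n @^-1` (F k `*` G k)).
  rewrite -preimage_bigcup -[LHS](preimage_setT (@row_uncons R n)); congr (_ @^-1` _).
  rewrite -setXTT TF TG predeqE => -[x y]; split.
    move=> [/= [i _ Fix] [j _ Gjy]]; exists (maxn i j) => //; split.
    - by move: x Fix; exact/subsetPset/ndF/leq_maxl.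
    - by move: y Gjy; exact/subsetPset/ndG/leq_maxr.
  by move=> [i _ []/= ? ?]; split; exists i.
move=> k; have [? ?] := Foo k; have [? ?] := Goo k; split.
  rewrite -[X in measurable X]setTI; apply: measurable_row_uncons => //.
  exact: measurableX.
rewrite /lebesgue_step /pushforward -comp_preimage.
rewrite (_ : _ \o _ = id); last by apply/funext => z /=; rewrite row_consK.
by rewrite preimage_id product_measure1E// lte_mul_pinfty// ge0_fin_numE.
Qed.

HB.instance Definition _ := Measure_isSigmaFinite.Build _ _ _ lebesgue_step
  sigma_finite_lebesgue_step.

End lebesgue_rV_step.

Fixpoint lebesgue_rV {R : realType} (n : nat) :
    {sigma_finite_measure set 'rV[R]_n -> \bar R} :=
  match n with
  | 0 => \d_(0 : 'rV[R]_0)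
  | n'.+1 => lebesgue_step (lebesgue_rV n')
  end.

(* These values on boxes characterize Lebesgue measure. *)
Lemma lebesgue_rV_box (R : realType) n (A : 'I_n -> set R) :
  (forall i, measurable (A i)) ->
  lebesgue_rV n [set x | forall i, A i (x ord0 i)] =
  (\prod_(i < n) lebesgue_measure (A i))%E.
Proof.
elim: n A => [|n IHn] A mA.
  by rewrite big_ord0 /= diracE mem_set//; case.
rewrite big_ord_recl -IHn; last by move=> i; exact: mA.
have mB : measurable [set x : 'rV[R]_n | forall i, A (lift ord0 i) (x ord0 i)].
  rewrite (_ : [set _ | _] = \bigcap_(i in [set: 'I_n])
      (@rV_coord R n i @^-1` A (lift ord0 i))); last first.
    by apply/seteqP; split=> x /= Ax i; [move=> _|]; exact: Ax.
  apply: fin_bigcap_measurable => // i _.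
  by rewrite -[X in measurable X]setTI; exact: measurable_rV_coord.
apply: etrans (product_measure1E (@lebesgue_measure R) (lebesgue_rV n) (mA ord0) mB).
rewrite /= /lebesgue_step /pushforward.
congr (_ _); apply/seteqP; split=> z /=.
  by move=> Az; split=> [|i]; [rewrite -row_cons0|rewrite -row_consS]; exact: Az.
move=> [Az0 AzS] i; have [j ->|->] := unliftP ord0 i.
  by rewrite row_consS; exact: AzS.
by rewrite row_cons0.
Qed.

Section domains.
Context {R : realType} {n : nat}.
Implicit Types (Omega U : set 'rV[R]_n) (f rho : 'rV[R]_n -> R) (x v : 'rV[R]_n).

Definition partial (i : 'I_n) f : 'rV[R]_n -> R :=
  fun x => 'D_(delta_mx ord0 i) f x.

Definition has_partial (i : 'I_n) f x : Prop := derivable f x (delta_mx ord0 i).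

Definition grad f x : 'rV[R]_n := \row_i partial i f x.

Definition laplacian f x : R := \sum_(i < n) partial i (partial i f) x.

(* The norm `|x| of the library on 'rV[R]_n is the sup norm, hence the need for
   an explicit Euclidean structure. *)
Definition dotv x v : R := \sum_(i < n) x ord0 i * v ord0 i.

Definition enorm x : R := Num.sqrt (dotv x x).

Fixpoint Ck_on (k : nat) U f : Prop :=
  (forall x, U x -> {for x, continuous f}) /\
  match k with
  | 0 => True
  | k'.+1 => forall i, (forall x, U x -> has_partial i f x) /\
                       Ck_on k' U (partial i f)
  end.

Definition smooth_on U f : Prop := forall k, Ck_on k U f.

Definition boundary Omega : set 'rV[R]_n := closure Omega `\` interior Omega.

(* For x on the boundary of Omega, these conditions imply that rho x = 0 and
   that, inside U, the boundary of Omega is the hypersurface rho = 0. *)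
Record local_defining_function Omega x U rho : Prop := LocalDefiningFunction {
  ldf_open : open U;
  ldf_mem : U x;
  ldf_smooth : smooth_on U rho;
  ldf_regular : forall y, U y -> grad rho y != 0;
  ldf_side : Omega `&` U = [set y | rho y < 0] `&` U
}.

Definition smooth_boundary Omega : Prop :=
  forall x, boundary Omega x -> exists U rho, local_defining_function Omega x U rho.

Record bounded_smooth_domain Omega : Prop := BoundedSmoothDomain {
  bsd_nonempty : Omega !=set0;
  bsd_open : open Omega;
  bsd_connected : connected Omega;
  bsd_bounded : bounded_set Omega;
  bsd_smooth : smooth_boundary Omega
}.

(* rho increases from Omega to its complement, so its gradient points outward;
   the normalized gradient does not depend on the choice of rho. *)
Definition outward_unit_normal Omega x v : Prop :=
  exists U rho, local_defining_function Omega x U rho /\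
    v = (enorm (grad rho x))^-1 *: grad rho x.

(* A function is C^1 up to the boundary when its gradient on Omega extends
   continuously to the closure. *)
Definition C1_closure Omega f : Prop :=
  [/\ {within closure Omega, continuous f},
      forall x, Omega x -> forall i, has_partial i f x &
      exists2 g : 'rV[R]_n -> 'rV[R]_n,
        {within closure Omega, continuous g} &
        forall x, Omega x -> g x = grad f x].

(* The functions below are total with irrelevant values off the closure of
   Omega, so the gradient at a boundary point is taken to be the limit of the
   gradient from inside Omega. *)
Definition trace_grad Omega f x : 'rV[R]_n :=
  lim (grad f y @[y --> within Omega (nbhs x)]).

Lemma trace_gradE Omega f (g : 'rV[R]_n -> 'rV[R]_n) x :
  {within closure Omega, continuous g} ->
  (forall y, Omega y -> g y = grad f y) ->
  closure Omega x -> trace_grad Omega f x = g x.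
Proof.
move=> /subspace_continuousP cg gE cx.
have PF : ProperFilter (within Omega (nbhs x)) by exact: within_nbhs_proper.
apply: cvg_lim; first exact: norm_hausdorff.
move=> B /(cg _ cx) nB.
apply: (@filterS _ (nbhs x) _ _ _ _ nB) => y /= By Oy.
by rewrite -gE//; apply: By; exact: subset_closure.
Qed.

Definition normal_derivative Omega v f x : R := dotv (trace_grad Omega f x) v.

End domains.

Section problem.
Context {R : realType} {n : nat}.
Implicit Types (Omega : set 'rV[R]_n) (T : R) (u c : 'rV[R]_n -> R -> R)
  (nu : 'rV[R]_n -> 'rV[R]_n) (k : 'rV[R]_n -> 'rV[R]_n -> R -> R).

Definition Q_ Omega T : set ('rV[R]_n * R) := Omega `*` `]0, T[%classic.
Definition S_ Omega T : set ('rV[R]_n * R) := boundary Omega `*` `]0, T[%classic.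
Definition Gamma_ Omega T : set ('rV[R]_n * R) :=
  S_ Omega T `|` closure Omega `*` [set 0].

Definition locally_holder (alpha : R) (D : set ('rV[R]_n * R))
    (f : 'rV[R]_n * R -> R) : Prop :=
  forall K : set ('rV[R]_n * R), compact K -> K `<=` D ->
    exists M : R, forall z w, K z -> K w ->
      `|f z - f w| <= M * `|z - w| `^ alpha.

Record C21 Omega T u : Prop := IsC21 {
  C21_continuous : {within Q_ Omega T, continuous (fun z => u z.1 z.2)};
  C21_derivable_t : forall x t, Q_ Omega T (x, t) -> derivable (u x) t 1;
  C21_continuous_t :
    {within Q_ Omega T, continuous (fun z => derive1 (u z.1) z.2)};
  C21_has_partial : forall i x t, Q_ Omega T (x, t) -> has_partial i (u^~ t) x;
  C21_continuous_partial : forall i,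
    {within Q_ Omega T, continuous (fun z => partial i (u^~ z.2) z.1)};
  C21_has_partial2 : forall i j x t, Q_ Omega T (x, t) ->
    has_partial i (partial j (u^~ t)) x;
  C21_continuous_partial2 : forall i j,
    {within Q_ Omega T, continuous (fun z => partial i (partial j (u^~ z.2)) z.1)}
}.

(* C^{1,0}(Q_T U Gamma_T): the set Q_T U Gamma_T is the product of the closure
   of Omega by [0, T[, and the spatial gradient, defined for x in Omega and
   0 <= t < T, extends continuously to it. *)
Record C10 Omega T u : Prop := IsC10 {
  C10_continuous :
    {within Q_ Omega T `|` Gamma_ Omega T, continuous (fun z => u z.1 z.2)};
  C10_has_partial : forall i x (t : R), Omega x -> 0 <= t < T ->
    has_partial i (u^~ t) x;
  C10_continuous_grad : exists2 g : 'rV[R]_n * R -> 'rV[R]_n,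
    {within Q_ Omega T `|` Gamma_ Omega T, continuous g} &
    forall x (t : R), Omega x -> 0 <= t < T -> g (x, t) = grad (u^~ t) x
}.

Record supersolution Omega nu (p l : R) c k
    (u0 : 'rV[R]_n -> R) T u : Prop := Supersolution {
  super_ge0 : forall x t, (Q_ Omega T `|` Gamma_ Omega T) (x, t) -> 0 <= u x t;
  super_C21 : C21 Omega T u;
  super_C10 : C10 Omega T u;
  super_equation : forall x t, Q_ Omega T (x, t) ->
    derive1 (u x) t >= laplacian (u^~ t) x - c x t * u x t `^ p;
  super_boundary : forall x (t : R), boundary Omega x -> 0 <= t < T ->
    normal_derivative Omega (nu x) (u^~ t) x >=
    \int[lebesgue_rV n]_(y in Omega) (k x y t * u y t `^ l);
  super_initial : forall x, Omega x -> u x 0 >= u0 x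
}.

Record subsolution Omega nu (p l : R) c k
    (u0 : 'rV[R]_n -> R) T u : Prop := Subsolution {
  sub_ge0 : forall x t, (Q_ Omega T `|` Gamma_ Omega T) (x, t) -> 0 <= u x t;
  sub_C21 : C21 Omega T u;
  sub_C10 : C10 Omega T u;
  sub_equation : forall x t, Q_ Omega T (x, t) ->
    derive1 (u x) t <= laplacian (u^~ t) x - c x t * u x t `^ p;
  sub_boundary : forall x (t : R), boundary Omega x -> 0 <= t < T ->
    normal_derivative Omega (nu x) (u^~ t) x <=
    \int[lebesgue_rV n]_(y in Omega) (k x y t * u y t `^ l);
  sub_initial : forall x, Omega x -> u x 0 <= u0 x
}.

End problem.

(* Main.v *)
Require Import Defs.
From HB Require Import structures.
From mathcomp Require Import all_boot all_order all_algebra.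
From mathcomp Require Import all_classical all_reals all_analysis.
From mathcomp Require Import measurable_realfun finmap lra ring.

(** The difference [w := u_low - u_up] satisfies a differential inequality to
    which the classical maximum principle argument applies, once the nonlocal
    flux is dominated by a barrier.

    Where [w] is positive, monotonicity of [r `^ p] and [c >= 0] turn the
    equations into [w_t <= laplacian w], with no Lipschitz property of [r `^ p].
    On the boundary, [a `^ l - b `^ l <= L * (a - b)] when [a > b], the constant
    [L] being uniform because [a] stays bounded, and away from 0 if [l < 1]
    ([powR_sub_le], [powR_slope_bound]). Hence, for [m >= 0], the normal derivative
    of [w] is at most [K * m] as soon as [w <= m] in [Omega] at the same time, where [K] involves [L], a bound on [k] and the volume of [Omega].

    Such a [w], nonpositive initially, remains nonpositive
    ([nonlocal_flux_maximum_principle]). Let [psi >= 1] be a function on the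
    closure of [Omega] with bounded Laplacian, let [lam] be large, and let [m]
    be the maximum of [w / (expR (lam * t) * psi)], reached at [(x0, s0)]. If
    [m > 0] then [w] is touched from above at [(x0, s0)] by
    [m * expR (lam * t) * psi]. At an interior point, comparing the time
    derivatives and the Laplacians of the two functions gives
    [lam * psi x0 <= laplacian psi x0], which is false for [lam] large. At a
    boundary point, comparing the normal derivatives shows that the normal
    derivative of [psi] at [x0] is at most [K] times any upper bound of [psi].

    It remains to find [psi] whose normal derivative on the boundary exceeds
    [K] times an upper bound ([steepable_boundary]). Near a boundary point [x],
    with a defining function [rho], take the positive part of
    [r ^+ 2 - |y - x| ^+ 2 + A * rho y], raised to the power 3 to make it twice
    differentiable, and cut off outside the ball of radius [r]. As [rho < 0] in
    [Omega] the cutoff is invisible there, and the values do not exceed [r ^+ 6]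
    whatever [A] is, whereas the normal derivative at the boundary grows like
    [A]. By compactness of the boundary finitely many such functions suffice,
    and [psi] is 1 plus their sum. *)

Set Implicit Arguments.
Unset Strict Implicit.
Unset Printing Implicit Defensive.

Import Order.TTheory GRing.Theory Num.Theory.
Import numFieldNormedType.Exports.

Local Open Scope classical_set_scope.
Local Open Scope ring_scope.

(** * Directional derivatives and extrema *)

Lemma is_derive_cvgP (R : numFieldType) (V W : normedModType R) (f : V -> W)
    x v d :
  is_derive x v f d <-> h^-1 *: (f (h *: v + x) - f x) @[h --> 0^'] --> d.
Proof.
split=> [[df <-]//|cf]; split; first by apply/cvg_ex; exists d.
exact: cvg_lim.
Qed.

Lemma is_derive_line (R : numFieldType) (V W : normedModType R) (f : V -> W)
    (y v : V) (s : R) d :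
  is_derive (y + s *: v) v f d <-> is_derive s 1 (fun r => f (y + r *: v)) d.
Proof.
rewrite !is_derive_cvgP.
suff -> : (fun h : R => h^-1 *: (f (h *: v + (y + s *: v)) - f (y + s *: v))) =
  (fun h : R => h^-1 *: (f (y + (h *: 1 + s) *: v) - f (y + s *: v))) by [].
apply/funext => h; congr (_ *: (f _ - _)).
by rewrite [h *: 1]mulr1 scalerDl addrCA.
Qed.

Lemma is_derive_continuous (R : realFieldType) (f : R -> R) (x d : R) :
  is_derive x 1 f d -> {for x, continuous f}.
Proof.
by move=> [df _]; apply: differentiable_continuous; exact/derivable1_diffP.
Qed.

(** Taking [b] of either sign lets the increment in a direction be controlled
    without distinguishing the sign of the coefficient along it. *)
Lemma MVT_signed (R : realType) (F dF : R -> R) (b : R) :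
  (forall r : R, `|r| <= `|b| -> is_derive (r : R) (1 : R) F (dF r)) ->
  exists2 r, `|r| <= `|b| & F b - F 0 = b * dF r.
Proof.
move=> dFP.
have cF r : `|r| <= `|b| -> {for r, continuous F}.
  by move=> /dFP/is_derive_continuous.
have [b0|b0] := leP 0 b.
  have [||c] := @MVT_segment R F dF 0 b b0.
  - move=> x; rewrite in_itv/= => /andP[x0 xb]; apply: dFP.
    by rewrite !ger0_norm// ltW.
  - apply/subspace_continuousP => x /=; rewrite in_itv/= => /andP[x0 xb].
    by apply: cvg_within_filter; apply: cF; rewrite !ger0_norm.
  rewrite in_itv/= => /andP[c0 cb] ->; exists c; first by rewrite !ger0_norm.
  by rewrite subr0 mulrC.
have [||c] := @MVT_segment R F dF b 0 (ltW b0).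
- move=> x; rewrite in_itv/= => /andP[xb x0]; apply: dFP.
  by rewrite !ltr0_norm// lerN2 ltW.
- apply/subspace_continuousP => x /=; rewrite in_itv/= => /andP[xb x0].
  by apply: cvg_within_filter; apply: cF; rewrite !ler0_norm ?lerN2// ltW.
rewrite in_itv/= => /andP[cb c0] E; exists c.
  by rewrite !ler0_norm ?lerN2// ltW.
by rewrite -opprB E sub0r mulrN opprK mulrC.
Qed.

(** The increment along [h *: (v + a *: e)] splits into one along [h *: v] and
    one along [(h * a) *: e]; the second starts at a moving point, where the mean
    value theorem and the continuity of [d2] control it. *)
Lemma is_derive_dirD (R : realType) (V : normedModType R) (f : V -> R)
    (v e x : V) (a d1 : R) (d2 : V -> R) :
  is_derive x v f d1 ->
  (\forall y \near x, is_derive y e f (d2 y)) ->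
  {for x, continuous d2} ->
  is_derive x (v + a *: e) f (d1 + a * d2 x).
Proof.
move=> /is_derive_cvgP cf /nbhs_ballP[r0 /= r0_gt0 df] cd2.
apply/is_derive_cvgP.
suff cg : h^-1 *: (f (h *: v + x + (h * a) *: e) - f (h *: v + x))
    @[h --> 0^'] --> a * d2 x.
  apply: cvg_trans (cvgD cf cg); apply: near_eq_cvg; near=> h.
  rewrite -[LHS]/(_ *: _ + _ *: _) -scalerDr addrC subrKA; congr (_ *: (f _ - _)).
  by rewrite scalerDr scalerA addrAC.
apply/cvgrPdist_le => /= eps eps0.
have e1 : 0 < eps / (`|a| + 1) by rewrite divr_gt0// ltr_wpDl.
have /cvgrPdist_le/(_ _ e1)/nbhs_ballP[r1 /= r10 cd2'] := cd2.
set N := `|v| + `|a| * `|e| + 1.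
have N0 : 0 < N by rewrite /N ltr_wpDl// addr_ge0// mulr_ge0.
near=> h.
have hr : `|h| * N < Num.min r0 r1.
  rewrite -ltr_pdivlMr//; near: h; apply: dnbhs0_lt.
  by rewrite divr_gt0// lt_min r0_gt0.
have h0 : h != 0 by near: h; exact: nbhs_dnbhs_neq.
have inb r : `|r| <= `|h * a| -> ball x (Num.min r0 r1) (h *: v + x + r *: e).
  move=> rha; rewrite -ball_normE/=.
  rewrite opprD opprD addrA addrCA subrr addr0.
  apply: le_lt_trans hr; rewrite -opprD normrN.
  rewrite (le_trans (ler_normD _ _))// /N mulrDr mulrDr mulr1 !normrZ.
  rewrite -addrA lerD// ler_wpDr// mulrA -normrM ler_wpM2r//.
have le0 : Num.min r0 r1 <= r0 by rewrite ge_min lexx.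
have le1 : Num.min r0 r1 <= r1 by rewrite ge_min lexx orbT.
have [r rle Er] := @MVT_signed R (fun r => f (h *: v + x + r *: e))
  (fun r => d2 (h *: v + x + r *: e)) (h * a) (fun r rle =>
  (is_derive_line _ _ _ _ _).1 (df _ (le_ball le0 (inb r rle)))).
rewrite scale0r addr0 in Er.
rewrite Er [_ *: _]mulrA mulrA mulVf// mul1r -mulrBr normrM.
have /= H := cd2' _ (le_ball le1 (inb r rle)).
apply: le_trans (_ : `|a| * (eps / (`|a| + 1)) <= _); first by rewrite ler_wpM2l.
rewrite mulrCA ger_pMr// ler_pdivrMr ?ltr_wpDl// mul1r; lra.
Unshelve. all: by end_near.
Qed.

(** Continuous partial derivatives give all directional derivatives: the
    coordinates of [v] are added one at a time by [is_derive_dirD]. *)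
Lemma is_derive_grad (R : realType) n (f : 'rV[R]_n -> R) (x v : 'rV[R]_n) :
  (forall i, \forall y \near x, has_partial i f y) ->
  (forall i, {for x, continuous (partial i f)}) ->
  is_derive x v f (dotv (grad f x) v).
Proof.
move=> pf cf; rewrite {1}(row_sum_delta v) /dotv.
elim/big_rec2: _ => [|i d w _ IH]; first exact: is_derive0.
rewrite addrC [X in is_derive _ _ _ X]addrC [_ * v _ _]mulrC mxE.
apply: is_derive_dirD => //.
by apply: filterS (pf i) => y; exact: derivableP.
Qed.

(** A strictly positive second derivative would make the first one positive, and
    the function increasing, on the right of the maximum. *)
Lemma second_derivative_at_max (R : realType) (f f1 : R -> R) (f2 : R) :
  (\forall s \near (0 : R), is_derive (s : R) (1 : R) f (f1 s)) ->
  is_derive (0 : R) (1 : R) f1 f2 ->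
  (\forall s \near (0 : R), f s <= f 0) -> f2 <= 0.
Proof.
move=> /nbhs_ballP[r0 /= r0_gt0 df] df1 /nbhs_ballP[r1 /= r1_gt0 fmax].
set r := Num.min r0 r1.
have r_gt0 : 0 < r by rewrite lt_min r0_gt0.
have df' (s : R) : `|s| < r -> is_derive s (1 : R) f (f1 s).
  by rewrite lt_min => /andP[sr _]; apply: df; rewrite -ball_normE/= sub0r normrN.
have fmax' s : `|s| < r -> f s <= f 0.
  by rewrite lt_min => /andP[_ sr]; apply: fmax; rewrite -ball_normE/= sub0r normrN.
have f10 : f1 0 = 0.
  have d0 : is_derive (0 : R) (1 : R) f 0.
    apply: (@derive1_at_max R f (- r) r).
    - by rewrite ge0_cp// ltW.
    - move=> t; rewrite in_itv/= -ltr_norml => /df' dt.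
      by have [] := dt.
    - by rewrite in_itv/= oppr_lt0 r_gt0.
    - by move=> t; rewrite in_itv/= -ltr_norml => /fmax'.
  have [_ <-] : is_derive (0 : R) (1 : R) f (f1 0) by apply: df'; rewrite normr0.
  by have [_ ->] := d0.
rewrite leNgt; apply/negP => f2_gt0.
move: df1 => /is_derive_cvgP /cvgrPdist_lt /(_ _ f2_gt0).
rewrite near_withinE => /nbhs_ballP[r2 /= r2_gt0 H].
have f1_gt0 s : 0 < s -> s < r2 -> 0 < f1 s.
  move=> s0 sr; have := H s; rewrite -ball_normE/= sub0r normrN gtr0_norm//.
  move=> /(_ sr (lt0r_neq0 s0)).
  rewrite addr0 f10 subr0 [_ *: 1]mulr1 ltr_norml => /andP[_].
  by rewrite ltrBlDl ltrDr [_ *: _]mulrC pmulr_lgt0// invr_gt0.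
pose s := Num.min r r2 / 2.
have s0 : 0 < s by rewrite divr_gt0// lt_min r_gt0.
have [sr sr2] : s < r /\ s < r2.
  by apply/andP; rewrite -lt_min /s ltr_pdivrMr// ltr_pMr ?ltr1n// lt_min r_gt0.
have [||c] := @MVT R f f1 0 s s0.
- move=> x; rewrite in_itv/= => /andP[x0 xs].
  by apply: df'; rewrite gtr0_norm// (lt_trans xs).
- apply/subspace_continuousP => x /=; rewrite in_itv/= => /andP[x0 xs].
  apply: cvg_within_filter.
  have/is_derive_continuous : is_derive x 1 f (f1 x).
    by apply: df'; rewrite ger0_norm// (le_lt_trans xs).
  by [].
rewrite in_itv/= subr0 => /andP[c0 cs] E.
have : f s <= f 0 by apply: fmax'; rewrite gtr0_norm.
rewrite -subr_le0 E leNgt => /negP; apply.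
by rewrite mulr_gt0// f1_gt0// (lt_trans cs).
Qed.

Lemma derive_at_left_max (R : realType) (f : R -> R) (t d : R) :
  is_derive (t : R) (1 : R) f d -> (\forall s \near t^'-, f s <= f t) -> 0 <= d.
Proof.
move=> /is_derive_cvgP df fmax.
rewrite leNgt; apply/negP => d0.
move: df => /cvgrPdist_lt; rewrite -oppr_gt0 in d0 => /(_ _ d0).
rewrite near_withinE => /nbhs_ballP[r2 /= r2_gt0 H].
move: fmax; rewrite near_withinE => /nbhs_ballP[r1 /= r1_gt0 fmax].
pose s := Num.min r1 r2 / 2.
have s0 : 0 < s by rewrite divr_gt0// lt_min r1_gt0.
have [sr sr2] : s < r1 /\ s < r2.
  by apply/andP; rewrite -lt_min /s ltr_pdivrMr// ltr_pMr ?ltr1n// lt_min r1_gt0.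
have := H (- s); rewrite -ball_normE/= sub0r opprK gtr0_norm// oppr_eq0.
move=> /(_ sr2 (lt0r_neq0 s0)); rewrite ltr_norml => /andP[+ _].
rewrite opprK ltrBrDr -subr_gt0 opprD addrA subrr sub0r => H1.
have := fmax (t - s).
rewrite -ball_normE/= opprD addrA subrr sub0r opprK gtr0_norm//.
rewrite ltrBlDr ltrDl => /(_ sr s0).
rewrite -subr_le0 => H2.
move: H1; rewrite [_ *: 1]mulr1 [- s + t]addrC invrN [_ *: _]mulNr opprK.
by rewrite pmulr_rgt0 ?invr_gt0// ltNge H2.
Qed.

(** * Measurability and Lebesgue measure of sets of row vectors *)

(** An open set is the union of the cubes with rational centre and radius
    [1 / (m + 1)] that it contains, and these are countably many. *)
Lemma open_measurable_rV (R : realType) n (O : set 'rV[R]_n) :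
  open O -> measurable O.
Proof.
move=> oO.
pose box (q : 'rV[rat]_n * nat) : set 'rV[R]_n :=
  [set x | forall i, `|x ord0 i - ratr (q.1 ord0 i)| < q.2.+1%:R^-1].
have mbox q : measurable (box q).
  rewrite (_ : box q = \bigcap_(i in [set: 'I_n]) (@rV_coord R n i @^-1`
      `]ratr (q.1 ord0 i) - q.2.+1%:R^-1, ratr (q.1 ord0 i) + q.2.+1%:R^-1[)).
    apply: fin_bigcap_measurable => // i _.
    by rewrite -[X in measurable X]setTI; exact: measurable_rV_coord.
  apply/seteqP; split=> x /= bx i; first move=> _; have := bx i;
    by rewrite ?(in_itv,ltr_distl)//=; apply.
rewrite (_ : O = \bigcup_q (if `[< box q `<=` O >] then box q else set0)).
  apply: countable_bigcupT_measurable; first exact: countableP.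
  by move=> q; case: ifPn.
apply/seteqP; split=> [x Ox|x [q _]]; last by case: asboolP => // qO /qO.
have /nbhs_ballP[e /= e0 eO] : nbhs x O by exact: open_nbhs_nbhs.
have [N] : exists N : nat, N.+1%:R^-1 < e / 2.
  have e2 : 0 < e / 2 by rewrite divr_gt0.
  have [N _ /(_ N (leqnn N)) HN] := near_infty_natSinv_lt (PosNum e2).
  by exists N.
move=> Ne.
have qP i : exists q : rat, `|x ord0 i - ratr q| < N.+1%:R^-1.
  have [|q] := @rat_in_itvoo R (x ord0 i - N.+1%:R^-1) (x ord0 i + N.+1%:R^-1).
    by rewrite ltrBlDr -addrA ltrDl addr_gt0.
  by rewrite in_itv/= -ltr_distl distrC; exists q.
pose q : 'rV[rat]_n := \row_i sval (cid (qP i)).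
have xq : box (q, N) x by move=> i /=; rewrite mxE; case: (cid (qP i)).
exists (q, N) => //; case: asboolP => // -[] y yq; apply: eO.
split=> // i j; rewrite ord1; rewrite /ball/= -(subrKA (ratr (q ord0 j))).
rewrite (le_lt_trans (ler_normD _ _))// [e]splitr ltrD//.
  by rewrite (lt_trans _ Ne).
by rewrite distrC (lt_trans _ Ne).
Qed.

Lemma within_continuous_measurable_rV (R : realType) n (O : set 'rV[R]_n)
    (f : 'rV[R]_n -> R) :
  open O -> {within O, continuous f} -> measurable_fun O f.
Proof.
move=> oO /continuousP cf; apply: (measurability _ (RGenOpens.measurableE R)).
move=> _ [_ [a [b ->] <-]].
have /open_subspaceP[V oV VE] := cf _ 
  (interval_open (a := BRight a) (b := BLeft b) isT isT).
by rewrite setIC -VE; apply: open_measurable_rV; exact: openI.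
Qed.

Lemma le_coord_norm (R : realType) n (x : 'rV[R]_n) i : `|x ord0 i| <= `|x|.
Proof.
rewrite [leRHS]/Num.Def.normr /= mx_normrE; apply/bigmax_geP; right => /=.
by exists (ord0, i).
Qed.

Lemma lebesgue_rV_bounded_fin (R : realType) n (A : set 'rV[R]_n) :
  measurable A -> bounded_set A -> (lebesgue_rV n A < +oo)%E.
Proof.
move=> mA [M [Mreal /(_ (M + 1))]]; rewrite ltrDl => /(_ ltr01) AM.
pose J : set R := `[- (M + 1), M + 1]%classic.
pose box : set 'rV[R]_n := [set x | forall i, J (x ord0 i)].
have mbox : measurable box.
  have -> : box = \bigcap_(i in [set: 'I_n]) (@rV_coord R n i @^-1` J).
    apply/seteqP; split=> x Ax i; first by move=> _; exact: Ax.
    exact: (Ax i I).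
  apply: fin_bigcap_measurable => // i _.
  rewrite -[X in measurable X]setTI; apply: measurable_rV_coord => //.
  exact: measurable_itv.
apply: (@le_lt_trans _ _ (lebesgue_rV n box)).
  apply: le_measure; [exact: mem_set|exact: mem_set|].
  move=> x /AM xM i; rewrite /J/= in_itv/= -ler_norml.
  exact: le_trans (le_coord_norm _ _) xM.
rewrite (@lebesgue_rV_box R n (fun=> J)); last first.
  by move=> i; exact: measurable_itv.
rewrite big_const_ord; elim: n {A mA AM box mbox} => [|n IH] /=.
  exact: ltry.
rewrite lte_mul_pinfty//.
  by rewrite ge0_fin_numE// /J lebesgue_measure_itv/=; case: ifP => _; exact: ltry.
Qed.

Lemma Rintegral_leDr d (X : measurableType d) (R : realType)
    (mu : {measure set X -> \bar R}) (D : set X) (f g : X -> R) (C : R) :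
  measurable D -> (mu D < +oo)%E ->
  measurable_fun D f -> [bounded f x | x in D] ->
  measurable_fun D g -> [bounded g x | x in D] ->
  (forall x, D x -> f x <= g x + C) ->
  \int[mu]_(x in D) f x <= \int[mu]_(x in D) g x + C * fine (mu D).
Proof.
move=> mD Doo mf bf mg bg fg.
have i_f := measurable_bounded_integrable mD Doo mf bf.
have i_g := measurable_bounded_integrable mD Doo mg bg.
have i_C : mu.-integrable D (EFin \o cst C).
  by apply: measurable_bounded_integrable => //; exact: bounded_cst.
rewrite -Rintegral_cst// -RintegralD//; apply: le_Rintegral => //.
by apply: eq_integrable (integrableD mD i_g i_C) => //.
Qed.

(** * Defining functions and the outward normal *)

Lemma dotvC (R : realType) n (x y : 'rV[R]_n) : dotv x y = dotv y x.
Proof. by apply: eq_bigr => i _; rewrite mulrC. Qed.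

Lemma dotvDl (R : realType) n (x y z : 'rV[R]_n) :
  dotv (x + y) z = dotv x z + dotv y z.
Proof. by rewrite -big_split; apply: eq_bigr => i _; rewrite mxE mulrDl. Qed.

Lemma dotvZl (R : realType) n (a : R) (x y : 'rV[R]_n) :
  dotv (a *: x) y = a * dotv x y.
Proof. by rewrite /dotv mulr_sumr; apply: eq_bigr => i _; rewrite mxE mulrA. Qed.

Lemma dotvNl (R : realType) n (x y : 'rV[R]_n) : dotv (- x) y = - dotv x y.
Proof. by rewrite -scaleN1r dotvZl mulN1r. Qed.

Lemma dotvDr (R : realType) n (x y z : 'rV[R]_n) :
  dotv z (x + y) = dotv z x + dotv z y.
Proof. by rewrite ![dotv z _]dotvC dotvDl. Qed.

Lemma dotvZr (R : realType) n (a : R) (x y : 'rV[R]_n) :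
  dotv y (a *: x) = a * dotv y x.
Proof. by rewrite ![dotv y _]dotvC dotvZl. Qed.

Lemma dotvNr (R : realType) n (x y : 'rV[R]_n) : dotv y (- x) = - dotv y x.
Proof. by rewrite ![dotv y _]dotvC dotvNl. Qed.

Lemma sqr_coord_le_dotv (R : realType) n (x : 'rV[R]_n) i :
  x ord0 i ^+ 2 <= dotv x x.
Proof.
rewrite /dotv (bigD1 i)//= -expr2 lerDl sumr_ge0// => j _.
by rewrite -expr2 sqr_ge0.
Qed.

Lemma dotv_ge0 (R : realType) n (x : 'rV[R]_n) : 0 <= dotv x x.
Proof. by rewrite sumr_ge0// => j _; rewrite -expr2 sqr_ge0. Qed.

Lemma dotv_gt0 (R : realType) n (x : 'rV[R]_n) : x != 0 -> 0 < dotv x x.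
Proof.
move=> /eqP/rowP x0; rewrite lt_def dotv_ge0 andbT; apply/eqP => d0.
apply: x0 => i; rewrite mxE; apply/eqP; rewrite -sqrf_eq0.
by rewrite eq_le sqr_ge0 andbT -d0 sqr_coord_le_dotv.
Qed.

Lemma enormK (R : realType) n (x : 'rV[R]_n) : enorm x ^+ 2 = dotv x x.
Proof. by rewrite sqr_sqrtr// dotv_ge0. Qed.

Lemma coord_le_enorm (R : realType) n (x : 'rV[R]_n) i :
  `|x ord0 i| <= enorm x.
Proof. by rewrite -sqrtr_sqr ler_wsqrtr// sqr_coord_le_dotv. Qed.

(** The hypothesis forces [g2] to be a positive multiple of [g1]. The conclusion
    only retains equality in the Cauchy-Schwarz inequality, which is what slopes
    along the normal depend on. *)
Lemma halfspace_enorm (R : realType) n (g1 g2 : 'rV[R]_n) :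
  g1 != 0 -> g2 != 0 ->
  (forall v, dotv g1 v < 0 -> dotv g2 v <= 0) ->
  enorm g1 <= dotv g1 ((enorm g2)^-1 *: g2).
Proof.
move=> g10 g20 H; set a := dotv g1 g1; set b := dotv g1 g2.
have a0 : 0 < a by exact: dotv_gt0.
have e2 : 0 < enorm g2 by rewrite sqrtr_gt0 dotv_gt0.
have b0 : 0 <= b.
  by have := H (- g1); rewrite !dotvNr !oppr_lt0 oppr_le0 dotvC => /(_ a0).
have K : dotv g2 g2 * a <= b ^+ 2.
  set v := g2 - (b / a) *: g1.
  have v1 : dotv g1 v = 0.
    by rewrite /v dotvDr dotvNr dotvZr -/a -/b divfK ?subrr// gt_eqF.
  suff : dotv g2 v <= 0.
    rewrite /v dotvDr dotvNr dotvZr subr_le0 [dotv g2 g1]dotvC -/b mulrAC.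
    by rewrite ler_pdivlMr// expr2.
  (* [v] is orthogonal to [g1]: tilting it slightly enters the open half-space. *)
  apply/ler_addgt0Pl => e e0.
  pose d := e / (b + 1).
  have d0 : 0 < d by rewrite divr_gt0// ltr_wpDl.
  have := H (v - d *: g1).
  rewrite !(dotvDr v) !(dotvNr (d *: g1)) !(dotvZr d) v1 sub0r.
  rewrite oppr_lt0 mulr_gt0// => /(_ isT).
  rewrite [dotv g2 g1]dotvC -/b subr_le0 addr0 => /le_trans; apply.
  by rewrite /d mulrAC ler_pdivrMr ?ltr_wpDl// ler_wpM2l ?ltW// ltrDl.
rewrite dotvZr -/b mulrC ler_pdivlMr// -(ler_pXn2r (n := 2))//.
- by rewrite exprMn !enormK mulrC.
- by rewrite nnegrE mulr_ge0// sqrtr_ge0.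
Qed.

Section defining_function.
Context {R : realType} {n : nat}.
Implicit Types (Omega U : set 'rV[R]_n) (f rho : 'rV[R]_n -> R).
Implicit Types (x y v : 'rV[R]_n).

Lemma is_derive_slope_lt f x v (d c : R) :
  is_derive x v f d -> d < c ->
  \forall s \near 0^'+, f (x + s *: v) < f x + c * s.
Proof.
move=> /is_derive_cvgP df dc; have : 0 < c - d by rewrite subr_gt0.
move/cvgrPdist_lt : df => /[apply].
rewrite !near_withinE; apply: filterS => s Hs s0.
have {Hs} := Hs (lt0r_neq0 s0).
rewrite ltr_distlC => /andP[_]; rewrite subrKC [_ *: _]mulrC ltr_pdivrMr//.
by rewrite ltrBlDl [_ + x]addrC.
Qed.

Lemma near_line x v (P : set 'rV[R]_n) :
  (\forall y \near x, P y) -> \forall s \near (0 : R)^'+, P (x + s *: v).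
Proof.
move=> xP.
suff : x + s *: v @[s --> (0 : R)] --> x by move=> /cvg_at_right_filter; apply.
have := @cvgD _ _ _ _ _ (cst x) (fun s : R => s *: v) x (0 *: v).
rewrite scale0r addr0; apply; first exact: cvg_cst.
rewrite -[X in _ --> X](scale0r v).
by apply: cvgZl; exact: cvg_id.
Qed.

Variables (Omega : set 'rV[R]_n) (oOmega : open Omega).

Lemma boundary_notin x : boundary Omega x -> ~ Omega x.
Proof. by case=> _; rewrite (interior_id _).1. Qed.

Context x U rho (H : local_defining_function Omega x U rho).

Lemma ldf_continuous y : U y -> {for y, continuous rho}.
Proof. by have [+ _] := ldf_smooth H 0; apply. Qed.

Lemma ldf_C1 y i : U y ->
  has_partial i rho y /\ {for y, continuous (partial i rho)}.
Proof.
move=> Uy; have [_ /(_ i)[dp [cp _]]] := ldf_smooth H 1.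
by split; [exact: dp|exact: cp].
Qed.

Lemma ldf_C2 y i : U y ->
  has_partial i (partial i rho) y /\
  {for y, continuous (partial i (partial i rho))}.
Proof.
move=> Uy; have [_ /(_ i)[_ [_ /(_ i)[dp [cp _]]]]] := ldf_smooth H 2.
by split; [exact: dp|exact: cp].
Qed.

Lemma ldf_near y : U y -> \forall z \near y, U z.
Proof. by move=> Uy; apply: open_nbhs_nbhs; split => //; exact: ldf_open H. Qed.

Lemma ldf_is_derive y v : U y -> is_derive y v rho (dotv (grad rho y) v).
Proof.
move=> Uy; apply: is_derive_grad => i; last by have [] := ldf_C1 i Uy.
by apply: filterS (ldf_near Uy) => z /(ldf_C1 i)[].
Qed.

Lemma ldf_in y : U y -> Omega y -> rho y < 0.
Proof.
move=> Uy Oy; have : (Omega `&` U) y by [].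
by rewrite (ldf_side H) => -[].
Qed.

Lemma ldf_lt0 y : U y -> rho y < 0 -> Omega y.
Proof.
move=> Uy ry; have : ([set y | rho y < 0] `&` U) y by [].
by rewrite -(ldf_side H) => -[].
Qed.

(** A point of [U] where [rho] is positive has a neighbourhood that [Omega]
    does not meet. *)
Lemma ldf_closure y : U y -> closure Omega y -> rho y <= 0.
Proof.
move=> Uy cy; rewrite leNgt; apply/negP => ry.
have : \forall z \near y, U z /\ 0 < rho z.
  apply: filterI; first exact: ldf_near.
  exact: (cvgr_gt (rho y) (ldf_continuous Uy)).
by move=> /cy[z [Oz [Uz]]]; rewrite ltNge ltW// ldf_in.
Qed.

Lemma ldf_boundary y : U y -> boundary Omega y -> rho y = 0.
Proof.
move=> Uy by_; apply/eqP; rewrite eq_le ldf_closure//=; last by case: by_.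
rewrite leNgt; apply/negP => /(ldf_lt0 Uy).
exact: boundary_notin.
Qed.

Lemma ldf_inward y v : U y -> boundary Omega y -> dotv (grad rho y) v < 0 ->
  \forall s \near 0^'+, Omega (y + s *: v).
Proof.
move=> Uy by_ gv; have ry := ldf_boundary Uy by_.
have := is_derive_slope_lt (ldf_is_derive v Uy) gv.
move: (near_line v (ldf_near Uy)).
by apply: filterS2 => s Us; rewrite ry mul0r addr0; exact: ldf_lt0.
Qed.

End defining_function.

(** The outward half-spaces of two defining functions agree at a boundary point,
    so the normal computed from one is parallel to the gradient of the other. *)
Lemma enorm_grad_le_normal (R : realType) n (Omega : set 'rV[R]_n) x U rho y nu :
  open Omega -> local_defining_function Omega x U rho -> U y ->
  boundary Omega y -> outward_unit_normal Omega y nu ->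
  enorm (grad rho y) <= dotv (grad rho y) nu.
Proof.
move=> oO H Uy by_ [U2 [rho2 [H2 ->]]].
apply: halfspace_enorm; first exact: (ldf_regular H).
  exact: (ldf_regular H2) (ldf_mem H2).
move=> v gv; rewrite leNgt; apply/negP => gv2.
have U2y := ldf_mem H2.
have N := ldf_inward oO H Uy by_ gv.
have D : is_derive y v (- rho2) (- dotv (grad rho2 y) v).
  exact: is_deriveN (ldf_is_derive H2 v U2y).
have gv2' : - dotv (grad rho2 y) v < 0 by rewrite oppr_lt0.
have N2 := is_derive_slope_lt D gv2'.
near (0 : R)^'+ => s.
have Us : U2 (y + s *: v).
  by near: s; apply: near_line; exact: (ldf_near H2 U2y).
have Os : Omega (y + s *: v) by near: s.
have : - rho2 (y + s *: v) < - rho2 y + 0 * s by near: s.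
rewrite (ldf_boundary oO H2 U2y by_) mul0r oppr0 addr0 oppr_lt0.
by rewrite ltNge ltW// (ldf_in H2).
Unshelve. all: by end_near.
Qed.

Lemma outward_unit_normal_unit (R : realType) n (Omega : set 'rV[R]_n) x nu :
  outward_unit_normal Omega x nu -> dotv nu nu = 1.
Proof.
move=> [U [rho [H ->]]]; rewrite dotvZl dotvZr mulrA -expr2 -enormK -exprMn.
have /dotv_gt0 g0 := ldf_regular H (ldf_mem H).
by rewrite mulVf ?expr1n// gt_eqF// sqrtr_gt0.
Qed.

(** * Barriers that are steep at the boundary *)

(** The exponent 2 at least makes the two one-sided derivatives agree at 0; a
    cube of a positive part is thus twice differentiable. *)
Lemma is_derive_posX (R : realType) (k : nat) (s : R) :
  is_derive s 1 (fun t => Num.max t 0 ^+ k.+2) (k.+2%:R * Num.max s 0 ^+ k.+1).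
Proof.
have [s0|s0|->] := ltgtP s 0.
- rewrite expr0n/= mulr0.
  refine (near_eq_is_derive _ (is_derive_cst (0 : R) s (1 : R))).
  near=> t; rewrite max_r ?expr0n//.
  by apply/ltW; near: t; exact: lt_nbhsl.
- have D := @is_deriveX R R id k.+2 s 1 1 (is_derive_id _ _).
  rewrite [_ *: 1]mulr1 in D; refine (near_eq_is_derive _ D).
  near=> t.
  have t0 : 0 <= t by apply/ltW; near: t; exact: lt_nbhsr.
  by rewrite max_l// exprfctE.
- rewrite expr0n/= mulr0; apply/is_derive_cvgP.
  apply/cvgr0Pnorm_le => e e0; near=> h.
  have h0 : h != 0 by near: h; exact: nbhs_dnbhs_neq.
  have h1 : `|h| <= 1 by apply: ltW; near: h; exact: dnbhs0_lt.
  rewrite [h *: 1]mulr1 addr0 maxxx expr0n subr0 normrZ normfV normrX.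
  rewrite ler_pdivrMl ?normr_gt0// exprS.
  have mh : `|Num.max h 0| <= `|h|.
    by have [?|?] := leP h 0; first by rewrite normr0.
  apply: ler_pM => //; rewrite ?exprn_ge0//.
  apply: (@le_trans _ _ `|h|); last first.
    by apply: ltW; near: h; exact: dnbhs0_lt.
  rewrite exprS (le_trans _ mh)// ler_piMr// exprn_ile1//.
  exact: le_trans h1.
Unshelve. all: by end_near.
Qed.

Lemma is_derive_posX_comp (R : realType) (V : normedModType R) (k : nat)
    (q : V -> R) (y v : V) (d : R) :
  is_derive y v q d ->
  is_derive y v (fun z => Num.max (q z) 0 ^+ k.+2)
    (k.+2%:R * Num.max (q y) 0 ^+ k.+1 * d).
Proof.
move=> dq.
have E : y + 0 *: v = y by rewrite scale0r addr0.
have dl : is_derive (0 : R) (1 : R) (fun r => q (y + r *: v)) d.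
  by apply/is_derive_line; rewrite E.
have := is_derive1_comp (is_derive_posX k (q (y + 0 *: v))) dl.
move=> /(is_derive_line (fun z => Num.max (q z) 0 ^+ k.+2) y v 0).
by rewrite E.
Qed.

Lemma cvg_dotv (R : realType) n (T : Type) (F : set_system T)
    (f g : T -> 'rV[R]_n) (a b : 'rV[R]_n) :
  Filter F -> f @ F --> a -> g @ F --> b ->
  dotv (f z) (g z) @[z --> F] --> dotv a b.
Proof.
move=> FF fa gb; apply: cvg_big => [|i _]; first exact: add_continuous.
have cc j := @coord_continuous R 1 n ord0 j.
exact: cvgM (cvg_comp _ _ fa (cc i a)) (cvg_comp _ _ gb (cc i b)).
Qed.

Lemma continuous_sqdist (R : realType) n (x : 'rV[R]_n) :
  continuous (fun y : 'rV[R]_n => dotv (y - x) (y - x)).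
Proof.
move=> y; have c : {for (y : 'rV[R]_n), continuous (fun z : 'rV[R]_n => z - x)}.
  by apply: continuousB; [exact: cvg_id|exact: cst_continuous].
exact: (@cvg_dotv R n _ (nbhs (y : 'rV[R]_n)) _ _ _ _ _ c c).
Qed.

Lemma is_derive_sqdist (R : realType) n (x y v : 'rV[R]_n) :
  is_derive y v (fun y : 'rV[R]_n => dotv (y - x) (y - x)) (2 * dotv (y - x) v).
Proof.
apply/is_derive_cvgP; set f := (X in X @ _ --> _).
have fE : {near (0 : R)^', (fun h => 2 * dotv (y - x) v + h * dotv v v) =1 f}.
  near=> h; rewrite /f.
  have h0 : h != 0 by near: h; exact: nbhs_dnbhs_neq.
  rewrite -(addrA (h *: v)); move: (y - x) => a.
  rewrite dotvDl !dotvDr !dotvZl !dotvZr [dotv v a]dotvC.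
  rewrite [_ *: _]mulrC; apply: (mulIf h0); rewrite divfK//; ring.
apply: cvg_trans (near_eq_cvg fE) _.
have c0 : h * dotv v v @[h --> (0 : R)^'] --> 0 * dotv v v.
  by apply: cvgMl; apply: cvg_within_filter; exact: cvg_id.
by have := cvgD (cvg_cst (2 * dotv (y - x) v)) c0; rewrite mul0r addr0; exact.
Unshelve. all: by end_near.
Qed.

(** The slope conditions at the boundary are inequalities between values, not
    between derivatives: only the behaviour of [phi] along the inner normal is
    compared with that of a solution. The partial
    derivatives are functions of their own, so that second derivatives are those
    of explicit formulas. *)
Record boundary_barrier (R : realType) n (Omega : set 'rV[R]_n)
    (nu : 'rV[R]_n -> 'rV[R]_n) (V : set 'rV[R]_n) (B Phi Lambda : R)
    (phi : 'rV[R]_n -> R) (phi1 phi2 : 'I_n -> 'rV[R]_n -> R) : Prop :=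
  BoundaryBarrier {
  bb_continuous : {within closure Omega, continuous phi};
  bb_range : forall y, closure Omega y -> 0 <= phi y <= Phi;
  bb_derive : forall i y, Omega y ->
    is_derive y (delta_mx ord0 i) phi (phi1 i y);
  bb_derive2 : forall i y, Omega y ->
    is_derive y (delta_mx ord0 i) (phi1 i) (phi2 i y);
  bb_laplacian : forall y, Omega y -> \sum_(i < n) phi2 i y <= Lambda;
  bb_inward : forall y, boundary Omega y ->
    \forall s \near 0^'+, phi (y - s *: nu y) <= phi y;
  bb_steep : forall y, boundary Omega y -> V y ->
    \forall s \near 0^'+, phi (y - s *: nu y) <= phi y - B * s
}.

Section local_barrier.
Context {R : realType} {n : nat}.
Variables (Omega : set 'rV[R]_n) (nu : 'rV[R]_n -> 'rV[R]_n).
Hypothesis oOmega : open Omega.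
Hypothesis nuP : forall y, boundary Omega y -> outward_unit_normal Omega y (nu y).
Variables (x : 'rV[R]_n) (U : set 'rV[R]_n) (rho : 'rV[R]_n -> R).
Hypothesis H : local_defining_function Omega x U rho.
Variables (r c M A : R).
Hypotheses (r_gt0 : 0 < r) (c_gt0 : 0 < c) (A_ge0 : 0 <= A).
Let E (y : 'rV[R]_n) : R := dotv (y - x) (y - x).
Hypothesis ballU : forall y, E y <= r ^+ 2 -> U y.
Hypothesis ball_grad : forall y, E y <= r ^+ 2 -> c <= enorm (grad rho y).
Hypothesis ball_partial : forall i y, E y <= r ^+ 2 ->
  `|partial i rho y| <= M /\ `|partial i (partial i rho) y| <= M.

Let q (y : 'rV[R]_n) : R := r ^+ 2 - E y + A * rho y.
Let q1 i (y : 'rV[R]_n) : R := A * partial i rho y - 2 * (y - x) ord0 i.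
Let q2 i (y : 'rV[R]_n) : R := A * partial i (partial i rho) y - 2.
Let pos (y : 'rV[R]_n) : R := Num.max (q y) 0.

(** In [Omega `&` U], [q] is at most [r ^+ 2 - E], so its positive part already
    vanishes outside the ball; the test on [E] extends the function by 0 outside
    [U], where [rho] is arbitrary. *)
Definition local_barrier y : R := if E y < r ^+ 2 then pos y ^+ 3 else 0.
Definition local_barrier1 i y : R :=
  if E y < r ^+ 2 then 3 * pos y ^+ 2 * q1 i y else 0.
Definition local_barrier2 i y : R :=
  if E y < r ^+ 2 then 6 * pos y * q1 i y ^+ 2 + 3 * pos y ^+ 2 * q2 i y else 0.

Let pos_ge0 y : 0 <= pos y. Proof. by rewrite le_max lexx orbT. Qed.

Let E_ge0 y : 0 <= E y. Proof. exact: dotv_ge0. Qed.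

Let pos_out y : U y -> closure Omega y -> r ^+ 2 <= E y -> pos y = 0.
Proof.
move=> Uy cy Ey; apply/max_idPr; rewrite /q -oppr_ge0 opprD opprB addr_ge0//.
  by rewrite subr_ge0.
by rewrite oppr_ge0 mulr_ge0_le0// (ldf_closure H).
Qed.

Let near_out y : ~ U y -> \forall z \near y, r ^+ 2 < E z.
Proof.
move=> Uy; have Ey : r ^+ 2 < E y by rewrite ltNge; apply/negP => /ballU.
have cE : {for y, continuous E} by exact: (@continuous_sqdist R n x y).
exact: (cvgr_gt (E y) cE).
Qed.

Let near_in y : U y -> Omega y -> \forall z \near y, U z /\ Omega z.
Proof.
move=> Uy Oy; apply: filterI; first exact: (ldf_near H).
exact: open_nbhs_nbhs.
Qed.

Let local_barrierE y : U y -> closure Omega y -> local_barrier y = pos y ^+ 3.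
Proof.
move=> Uy cy; rewrite /local_barrier; case: ltP => // Ey.
by rewrite pos_out// expr0n.
Qed.

Let local_barrier1E i y : U y -> Omega y ->
  local_barrier1 i y = 3 * pos y ^+ 2 * q1 i y.
Proof.
move=> Uy cy; rewrite /local_barrier1; case: ltP => // Ey.
by rewrite pos_out ?expr0n/= ?mulr0 ?mul0r//; exact: subset_closure.
Qed.

Let local_barrier2E i y : U y -> Omega y ->
  local_barrier2 i y = 6 * pos y * q1 i y ^+ 2 + 3 * pos y ^+ 2 * q2 i y.
Proof.
move=> Uy cy; rewrite /local_barrier2; case: ltP => // Ey.
rewrite pos_out ?expr0n/= ?mulr0 ?mul0r ?addr0//; exact: subset_closure.
Qed.

Let is_derive_q y i : U y -> is_derive y (delta_mx ord0 i) q (q1 i y).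
Proof.
move=> Uy; have [dr _] := ldf_C1 H i Uy.
have D1 := is_derive_cst (r ^+ 2) y (delta_mx ord0 i : 'rV[R]_n).
have D2 := is_derive_sqdist x y (delta_mx ord0 i).
have D3 := is_deriveZ A (derivableP dr).
apply: is_derive_eq (is_deriveD (is_deriveB D1 D2) D3) _.
rewrite sub0r addrC; congr (_ - 2 * _).
rewrite /dotv (bigD1 i)//= [delta_mx _ _ _ _]mxE !eqxx mulr1 big1 ?addr0// => j ji.
by rewrite [delta_mx _ _ _ _]mxE (negbTE ji) andbF mulr0.
Qed.

Let is_derive_q1 y i : U y -> is_derive y (delta_mx ord0 i) (q1 i) (q2 i y).
Proof.
move=> Uy; have [dr _] := ldf_C2 H i Uy.
have D3 := is_deriveZ A (derivableP dr).
have D : is_derive y (delta_mx ord0 i) (fun y => (y - x) ord0 i) 1.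
  apply/is_derive_cvgP; apply: (@cvg_trans _ (cst (1 : R) @ (0 : R)^'));
    last exact: cvg_cst.
  apply: near_eq_cvg; near=> h.
  have h0 : h != 0 by near: h; exact: nbhs_dnbhs_neq.
  by rewrite !mxE !eqxx mulr1 -addrA addrK [_ *: _]mulVf.
apply: is_derive_eq (is_deriveB D3 (is_deriveZ 2 D)) _.
by rewrite [2 *: _]mulr1.
Unshelve. all: by end_near.
Qed.

Let continuous_q y : U y -> {for y, continuous q}.
Proof.
move=> Uy; have c1 := ldf_continuous H Uy.
have c2 : {for y, continuous E} by exact: (@continuous_sqdist R n x y).
have c3 : {for y, continuous (cst (r ^+ 2) : 'rV[R]_n -> R)} by exact: cst_continuous.
have c4 : {for y, continuous (cst A : 'rV[R]_n -> R)} by exact: cst_continuous.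
exact: continuousD (continuousB c3 c2) (continuousM c4 c1).
Qed.

Lemma local_barrier_continuous : {within closure Omega, continuous local_barrier}.
Proof.
apply/subspace_continuousP => y cy.
change (local_barrier @ within (closure Omega) (nbhs y) --> local_barrier y).
have [Uy|Uy] := pselect (U y); last first.
  have E0 : \forall z \near y, (cst 0 : _ -> R) z = local_barrier z.
    by apply: filterS (near_out Uy) => z Ez; rewrite /local_barrier ltNge ltW.
  rewrite -(nbhs_singleton E0); apply: cvg_within_filter.
  by apply: cvg_trans (near_eq_cvg E0) _; exact: cvg_cst.
rewrite local_barrierE//; apply: cvg_trans.
  apply: near_eq_cvg; rewrite near_withinE.
  by apply: filterS (ldf_near H Uy) => z Uz cz; rewrite local_barrierE.
apply: cvg_within_filter.
have c0 : {for y, continuous (cst 0 : 'rV[R]_n -> R)} by exact: cst_continuous.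
have cp : {for y, continuous pos} by exact: continuous_max (continuous_q Uy) c0.
exact: (continuous_cvg _ (@exprn_continuous R 3 (pos y)) cp).
Qed.

Hypothesis M_ge0 : 0 <= M.

Let pos_le y : closure Omega y -> E y < r ^+ 2 -> pos y <= r ^+ 2.
Proof.
move=> cy Ey; rewrite ge_max sqr_ge0 andbT /q -addrA gerDl.
rewrite addrC subr_le0 (le_trans _ (E_ge0 y))// mulr_ge0_le0//.
by rewrite (ldf_closure H)//; apply: ballU; exact: ltW.
Qed.

(** Since [rho <= 0] where [U] meets the closure of [Omega], the bound does not
    involve [A]. *)
Lemma local_barrier_range y : closure Omega y -> 0 <= local_barrier y <= r ^+ 6.
Proof.
move=> cy; rewrite /local_barrier; case: ltP => Ey; last first.
  by rewrite lexx exprn_ge0// ltW.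
rewrite exprn_ge0//= (_ : r ^+ 6 = (r ^+ 2) ^+ 3); last by rewrite -exprM.
by rewrite ler_pXn2r ?nnegrE ?sqr_ge0// pos_le.
Qed.

Lemma local_barrier_derive i y : Omega y ->
  is_derive y (delta_mx ord0 i) local_barrier (local_barrier1 i y).
Proof.
move=> Oy; have [Uy|Uy] := pselect (U y); last first.
  have E0 : \forall z \near y, (cst 0 : _ -> R) z = local_barrier z.
    by apply: filterS (near_out Uy) => z Ez; rewrite /local_barrier ltNge ltW.
  have Ey := nbhs_singleton (near_out Uy).
  rewrite /local_barrier1 ltNge ltW//=.
  exact: near_eq_is_derive E0 (is_derive_cst _ _ _).
have E0 : \forall z \near y, pos z ^+ 3 = local_barrier z.
  apply: filterS (near_in Uy Oy) => z [Uz Oz].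
  by rewrite local_barrierE//; exact: subset_closure.
apply: near_eq_is_derive E0 _; rewrite local_barrier1E//.
exact: is_derive_posX_comp (is_derive_q i Uy).
Qed.

Lemma local_barrier_derive2 i y : Omega y ->
  is_derive y (delta_mx ord0 i) (local_barrier1 i) (local_barrier2 i y).
Proof.
move=> Oy; have [Uy|Uy] := pselect (U y); last first.
  have E0 : \forall z \near y, (cst 0 : _ -> R) z = local_barrier1 i z.
    by apply: filterS (near_out Uy) => z Ez; rewrite /local_barrier1 ltNge ltW.
  have Ey := nbhs_singleton (near_out Uy).
  rewrite /local_barrier2 ltNge ltW//=.
  exact: near_eq_is_derive E0 (is_derive_cst _ _ _).
have E0 : \forall z \near y, 3 * pos z ^+ 2 * q1 i z = local_barrier1 i z.
  by apply: filterS (near_in Uy Oy) => z [Uz Oz]; rewrite local_barrier1E.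
apply: near_eq_is_derive E0 _; rewrite local_barrier2E//.
have D1 := is_derive_posX_comp 0 (is_derive_q i Uy).
apply: is_derive_eq (is_deriveM (is_deriveZ 3 D1) (is_derive_q1 i Uy)) _.
rewrite -/(pos y) expr1.
change (3 * pos y ^+ 2 * q2 i y + q1 i y * (3 * (2 * pos y * q1 i y)) =
  6 * pos y * q1 i y ^+ 2 + 3 * pos y ^+ 2 * q2 i y).
ring.
Qed.

Lemma local_barrier_laplacian y : Omega y ->
  \sum_(i < n) local_barrier2 i y <=
  \sum_(i < n) (6 * r ^+ 2 * (A * M + 2 * r) ^+ 2 + 3 * r ^+ 4 * (A * M)).
Proof.
move=> Oy; apply: ler_sum => i _; rewrite /local_barrier2; case: ltP => Ey; last first.
  have r0 := ltW r_gt0.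
  have S0 : 0 <= A * M + 2 * r by rewrite addr_ge0// mulr_ge0.
  by rewrite addr_ge0// ?mulr_ge0// ?mulr_ge0// ?S0// exprn_ge0.
have [M1 M2] := ball_partial i (ltW Ey).
have pr : pos y <= r ^+ 2 by rewrite pos_le//; exact: subset_closure.
have pr2 : pos y ^+ 2 <= r ^+ 4.
  rewrite (_ : r ^+ 4 = (r ^+ 2) ^+ 2); last by rewrite -exprM.
  by rewrite ler_pXn2r ?nnegrE ?sqr_ge0.
have yr : `|(y - x) ord0 i| <= r.
  rewrite -(ler_pXn2r (n := 2)) ?nnegrE ?normr_ge0// ?(ltW r_gt0)//.
  by rewrite real_normK ?num_real// (le_trans (sqr_coord_le_dotv _ i))// ltW.
apply: lerD.
  apply: ler_pM; rewrite ?sqr_ge0 ?mulr_ge0//; first by rewrite ler_wpM2l.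
  rewrite -[leLHS]real_normK ?num_real// ler_pXn2r ?nnegrE ?addr_ge0 ?mulr_ge0//;
    last exact: ltW.
  rewrite (le_trans (ler_normB _ _))// !normrM (ger0_norm A_ge0).
  by rewrite (@ger0_norm _ 2)// lerD ?ler_wpM2l.
apply: le_trans (_ : 3 * pos y ^+ 2 * (A * M) <= _).
  rewrite ler_wpM2l ?mulr_ge0 ?sqr_ge0// /q2 lerBlDr.
  rewrite (le_trans (_ : _ <= A * M)) ?lerDl//.
  by rewrite ler_wpM2l// (le_trans (ler_norm _)).
by rewrite ler_wpM2r ?mulr_ge0// ler_wpM2l.
Qed.

Variable b : R.
Hypotheses (b_ge0 : 0 <= b) (b_le : b <= A * (c / 2) - (r ^+ 2 + 1)).

Let q_inward y : boundary Omega y -> E y <= r ^+ 2 ->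
  \forall s \near 0^'+, q (y - s *: nu y) <= q y - b * s.
Proof.
move=> by_ Ey; have Uy := ballU Ey; have cy := ball_grad Ey.
have gn := enorm_grad_le_normal oOmega H Uy by_ (nuP by_).
have gv : dotv (grad rho y) (- nu y) < - (c / 2).
  rewrite dotvNr ltrN2 (lt_le_trans _ (le_trans cy gn))//.
  by rewrite ltr_pdivrMr// ltr_pMr// ltr1n.
have := is_derive_slope_lt (ldf_is_derive H (- nu y) Uy) gv.
rewrite near_withinE => N; rewrite near_withinE; apply: filterS N => s + s0.
move=> /(_ s0); rewrite scalerN => rs.
have Es : E y - s * (E y + 1) <= E (y - s *: nu y).
  rewrite /E addrAC; move: (y - x) => a.
  have := dotv_ge0 (a - nu y).
  have := outward_unit_normal_unit (nuP by_).
  rewrite !(dotvDl, dotvDr, dotvNl, dotvNr, dotvZl, dotvZr) => ->.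
  rewrite [dotv (nu y) a]dotvC => P.
  have := mulr_ge0 (ltW s0) P; have := sqr_ge0 s; nra.
have Ers : s * (E y + 1) <= s * (r ^+ 2 + 1).
  by rewrite ler_wpM2l ?(ltW s0)// lerD2r.
have Ars : A * rho (y - s *: nu y) <= A * (rho y + - (c / 2) * s).
  by rewrite ler_wpM2l// ltW.
have bs : b * s <= (A * (c / 2) - (r ^+ 2 + 1)) * s.
  by rewrite ler_wpM2r// ltW.
rewrite /q; lra.
Qed.

(** Along the inner normal [rho] decreases at the rate [c / 2] at least, while
    the squared distance to [x] varies at the rate [r ^+ 2 + 1] at most. *)
Lemma local_barrier_inward y : boundary Omega y ->
  \forall s \near 0^'+, local_barrier (y - s *: nu y) <= local_barrier y.
Proof.
move=> by_; have cy : closure Omega y by case: by_.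
have [Ey|Ey] := leP (E y) (r ^+ 2).
  have N := q_inward by_ Ey; rewrite near_withinE in N; rewrite near_withinE.
  apply: filterS N => s + s0 => /(_ s0) qs.
  rewrite [leRHS]local_barrierE//; last exact: ballU.
  apply: le_trans (_ : pos (y - s *: nu y) ^+ 3 <= _).
    by rewrite /local_barrier; case: ifP => // _; rewrite exprn_ge0.
  rewrite ler_pXn2r ?nnegrE// ge_max pos_ge0 andbT.
  rewrite (le_trans qs)// le_max lerBlDr lerDl mulr_ge0// ltW//.
have cE : {for y, continuous E} by exact: (@continuous_sqdist R n x y).
have N : \forall z \near y, r ^+ 2 < E z by exact: (cvgr_gt (E y) cE).
apply: filterS (near_line (- nu y) N) => s; rewrite scalerN => Es.
by rewrite /local_barrier ltNge (ltW Es)/= ltNge (ltW Ey).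
Qed.

(** Near [x] the positive part is at least [r ^+ 2 / 2] on the boundary, so the
    cube turns the slope [b] of [q] into at least [b * (r ^+ 4 / 4)]. *)
Lemma local_barrier_steep y : boundary Omega y -> E y < r ^+ 2 / 2 ->
  \forall s \near 0^'+,
    local_barrier (y - s *: nu y) <= local_barrier y - b * (r ^+ 4 / 4) * s.
Proof.
move=> by_ Ey; have cy : closure Omega y by case: by_.
have r2 : 0 < r ^+ 2 by rewrite exprn_gt0.
have Ey2 : E y < r ^+ 2 by rewrite (lt_le_trans Ey)//; lra.
have Uy : U y by apply: ballU; exact: ltW.
have qy : r ^+ 2 / 2 <= q y.
  by rewrite /q (ldf_boundary oOmega H Uy by_) mulr0 addr0; move: Ey; lra.
have q0 : 0 < q y by rewrite (lt_le_trans _ qy)// divr_gt0.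
near=> s.
have s0 : 0 < s by near: s; exact: nbhs_right_gt.
have qs : q (y - s *: nu y) <= q y - b * s.
  by near: s; apply: q_inward by_ (ltW Ey2).
have sq : b * s <= q y.
  have s1 : s < q y / (b + 1).
    by near: s; apply: nbhs_right_lt; rewrite divr_gt0// ltr_wpDl.
  have b1 : 0 < b + 1 by rewrite ltr_wpDl.
  rewrite (ltr_pdivlMr _ _ b1) in s1.
  by rewrite (le_trans _ (ltW s1))// mulrC ler_wpM2l ?ltW// ltrDl.
rewrite [local_barrier y]local_barrierE// /pos [Num.max (q y) 0]max_l ?(ltW q0)//.
apply: le_trans (_ : pos (y - s *: nu y) ^+ 3 <= _).
  by rewrite /local_barrier; case: ifP => // _; rewrite exprn_ge0.
have bs : 0 <= b * s by rewrite mulr_ge0// ltW.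
apply: le_trans (_ : (q y - b * s) ^+ 3 <= _).
  by rewrite ler_pXn2r ?nnegrE ?subr_ge0// ge_max qs subr_ge0 sq.
have qq : r ^+ 4 / 4 <= q y ^+ 2.
  rewrite (_ : r ^+ 4 / 4 = (r ^+ 2 / 2) ^+ 2); last by field.
  by rewrite ler_pXn2r ?nnegrE// ltW// divr_gt0.
have cube (Q t w : R) : 0 <= t -> t <= Q -> t * w <= t * Q ^+ 2 ->
    (Q - t) ^+ 3 <= Q ^+ 3 - t * w.
  move=> t0 tQ tw; have Qt : 0 <= Q - t by rewrite subr_ge0.
  rewrite -subr_ge0.
  have -> : Q ^+ 3 - t * w - (Q - t) ^+ 3 =
    (t * Q ^+ 2 - t * w) + t * ((Q - t) * Q + (Q - t) ^+ 2) by ring.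
  rewrite addr_ge0 ?subr_ge0// mulr_ge0// addr_ge0 ?sqr_ge0// mulr_ge0//.
  exact: le_trans tQ.
by rewrite [b * _ * s]mulrAC; apply: cube => //; exact: ler_wpM2l.
Unshelve. all: by end_near.
Qed.

End local_barrier.

(** The bound is chosen before the slope: it is this uniformity that makes the
    slope at the boundary win over the integral of the barrier. *)
Definition steepable (R : realType) n (Omega : set 'rV[R]_n)
    (nu : 'rV[R]_n -> 'rV[R]_n) (V : set 'rV[R]_n) : Prop :=
  exists Phi, forall B, exists Lambda phi phi1 phi2,
    boundary_barrier Omega nu V B Phi Lambda phi phi1 phi2.

Lemma steepable_set0 (R : realType) n (Omega : set 'rV[R]_n) nu :
  steepable Omega nu set0.
Proof.
exists 0 => B; exists 0, (cst 0), (fun=> cst 0), (fun=> cst 0); split => //=.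
- by move=> y; exact: cst_continuous.
- by move=> y; rewrite lexx.
- by move=> i y _; exact: is_derive_cst.
- by move=> i y _; exact: is_derive_cst.
- by move=> y _; rewrite big1.
- by move=> y _; near=> s.
Unshelve. all: by end_near.
Qed.

(** The second barrier does not increase along the inner normals, hence does not
    spoil the slope of the first one, and conversely. *)
Lemma steepable_setU (R : realType) n (Omega : set 'rV[R]_n) nu V1 V2 :
  steepable Omega nu V1 -> steepable Omega nu V2 ->
  steepable Omega nu (V1 `|` V2).
Proof.
move=> [F1 S1] [F2 S2]; exists (F1 + F2) => B.
have [L1 [f [f1 [f2 Hf]]]] := S1 B; have [L2 [g [g1 [g2 Hg]]]] := S2 B.
exists (L1 + L2), (f \+ g), (fun i => f1 i \+ g1 i), (fun i => f2 i \+ g2 i).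
split => /=.
- move=> y; apply: (@continuousD _ _ (subspace (closure Omega))).
    exact: (bb_continuous Hf).
  exact: (bb_continuous Hg).
- move=> y cy; have /andP[a1 a2] := bb_range Hf cy.
  by have /andP[b1 b2] := bb_range Hg cy; rewrite addr_ge0// lerD.
- by move=> i y Oy; exact: is_deriveD (bb_derive Hf i Oy) (bb_derive Hg i Oy).
- by move=> i y Oy; exact: is_deriveD (bb_derive2 Hf i Oy) (bb_derive2 Hg i Oy).
- move=> y Oy; rewrite big_split lerD//; first exact: (bb_laplacian Hf).
  exact: (bb_laplacian Hg).
- move=> y by_; move: (bb_inward Hg by_); apply: filterS2 (bb_inward Hf by_) => s.
  exact: lerD.
- move=> y by_ [V1y|V2y].
    move: (bb_inward Hg by_); apply: filterS2 (bb_steep Hf by_ V1y) => s fs gs.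
    by rewrite addrAC lerD.
  move: (bb_steep Hg by_ V2y); apply: filterS2 (bb_inward Hf by_) => s fs gs.
  by rewrite -addrA lerD.
Qed.

(** The radius is chosen so that, on the ball, [rho] has a gradient bounded away
    from 0 and bounded second derivatives; [A] is then the only parameter left,
    and it is tuned to the slope [B]. *)
Lemma steepable_near_boundary_point (R : realType) n (Omega : set 'rV[R]_n) nu x :
  open Omega -> smooth_boundary Omega ->
  (forall y, boundary Omega y -> outward_unit_normal Omega y (nu y)) ->
  boundary Omega x -> exists V, [/\ open V, V x & steepable Omega nu V].
Proof.
move=> oO sO nuP /[dup] bx /sO[U [rho H]].
have Ux := ldf_mem H.
have [j gj] : exists j, partial j rho x != 0.
  apply/not_existsP => H0; move/eqP: (ldf_regular H Ux); apply.
  by apply/rowP => j; rewrite !mxE; apply/eqP; have /negP := H0 j; rewrite negbK.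
pose c := `|partial j rho x| / 2.
have c0 : 0 < c by rewrite divr_gt0// normr_gt0.
pose M : R := \sum_i `|partial i rho x| +
  \sum_i `|partial i (partial i rho) x| + 1.
have le_sum (F : 'I_n -> R) i : `|F i| <= \sum_i `|F i|.
  by rewrite (bigD1 i)//= lerDl sumr_ge0.
have M0 : 0 <= M by rewrite !addr_ge0// sumr_ge0.
have : \forall y \near x, [/\ U y, c <= `|partial j rho y| &
    forall i, `|partial i rho y| <= M /\ `|partial i (partial i rho) y| <= M].
  near=> y; split.
  - by near: y; exact: (ldf_near H Ux).
  - near: y; have [_ cj] := ldf_C1 H j Ux.
    apply: (cvgr_norm_ge (partial j rho x) cj).
    by rewrite /c ltr_pdivrMr// ltr_pMr ?ltr1n// normr_gt0.
  - near: y; apply: filter_forall => i; have [_ c1] := ldf_C1 H i Ux.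
    have [_ c2] := ldf_C2 H i Ux; apply: filterI.
      apply: (cvgr_norm_le (partial i rho x) c1).
      rewrite /M -addrA (le_lt_trans (le_sum (fun i => partial i rho x) i))// ltrDl.
      by rewrite ltr_wpDl// sumr_ge0.
    apply: (cvgr_norm_le (partial i (partial i rho) x) c2).
    rewrite /M (le_lt_trans (le_sum (fun i => partial i (partial i rho) x) i))//.
    by rewrite addrAC ltrDr ltr_wpDl// sumr_ge0.
move=> /nbhs_ballP[d /= d0 Hd].
pose r := d / 2; have r0 : 0 < r by rewrite divr_gt0.
have inball y : dotv (y - x) (y - x) <= r ^+ 2 -> ball x d y.
  move=> Ey; split=> // i k; rewrite ord1 /ball/= distrC.
  have : `|(y - x) ord0 k| <= r.
    rewrite -(ler_pXn2r (n := 2)) ?nnegrE ?normr_ge0// ?(ltW r0)//.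
    by rewrite real_normK ?num_real// (le_trans (sqr_coord_le_dotv _ k)).
  rewrite !mxE => /le_lt_trans; apply.
  by rewrite /r ltr_pdivrMr// ltr_pMr ?ltr1n.
have bU y : dotv (y - x) (y - x) <= r ^+ 2 -> U y by move=> /inball/Hd[].
have bg y : dotv (y - x) (y - x) <= r ^+ 2 -> c <= enorm (grad rho y).
  move=> /inball/Hd[_ cy _]; rewrite (le_trans cy)//.
  by have := coord_le_enorm (grad rho y) j; rewrite mxE.
have bp i y : dotv (y - x) (y - x) <= r ^+ 2 ->
    `|partial i rho y| <= M /\ `|partial i (partial i rho) y| <= M.
  by move=> /inball/Hd[].
exists [set y | dotv (y - x) (y - x) < r ^+ 2 / 2]; split.
- by apply: open_comp (@open_lt _ _) => y _; exact: continuous_sqdist.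
- by rewrite /= subrr /dotv big1 ?divr_gt0 ?exprn_gt0// => i _; rewrite mxE mul0r.
exists (r ^+ 6) => B.
pose b := `|B| / (r ^+ 4 / 4).
have r40 : 0 < r ^+ 4 / 4 by rewrite divr_gt0// exprn_gt0.
have b0 : 0 <= b by rewrite divr_ge0// ltW.
(* The slope of the argument of the cube along the inner normal is then [b]. *)
pose A := (b + (r ^+ 2 + 1)) / (c / 2).
have c20 : 0 < c / 2 by rewrite divr_gt0.
have A0 : 0 <= A by rewrite divr_ge0 ?addr_ge0 ?sqr_ge0// ltW.
have bA : b <= A * (c / 2) - (r ^+ 2 + 1) by rewrite divfK ?gt_eqF// addrK.
do 4 eexists; split.
- exact: (@local_barrier_continuous _ _ _ _ _ _ H r A A0 bU).
- move=> y cy; exact: (local_barrier_range H r0 A0 bU).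
- move=> i y Oy; exact: (local_barrier_derive oO H A0 bU).
- move=> i y Oy; exact: (local_barrier_derive2 oO H A0 bU).
- move=> y Oy; exact: (local_barrier_laplacian H r0 A0 bU bp M0 Oy).
- move=> y by_; exact: (local_barrier_inward oO nuP H c0 A0 bU bg b0 bA).
- move=> y by_ /= Vy.
  near=> s; have s0 : 0 < s by near: s; exact: nbhs_right_gt.
  apply: le_trans (_ : local_barrier x rho r A y - b * (r ^+ 4 / 4) * s <= _).
    by near: s; exact: (local_barrier_steep oO nuP H r0 c0 A0 bU bg b0 bA by_ Vy).
  rewrite lerD2l lerN2 /b divfK ?gt_eqF//.
  by rewrite ler_wpM2r ?ler_norm// ltW.
Unshelve. all: by end_near.
Qed.

Lemma closed_boundary (T : topologicalType) (A : set T) :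
  closed (closure A `\` interior A).
Proof.
by apply: closedI; [exact: closed_closure|apply/open_closedC/open_interior].
Qed.

Lemma bounded_closure (R : realType) n (A : set 'rV[R]_n) :
  bounded_set A -> bounded_set (closure A).
Proof.
move=> [M [Mr AM]]; exists M; split => // e Me x cx.
have cl : closed [set y : 'rV[R]_n | `|y| <= e].
  by apply: closed_comp (@closed_le _ _) => y _; exact: norm_continuous.
rewrite -/([set y : 'rV[R]_n | `|y| <= e] x) [X in X x]((closure_id _).1 cl).
apply: closure_subset cx => y Ay; exact: AM.
Qed.

Lemma steepable_boundary (R : realType) n (Omega : set 'rV[R]_n) nu :
  bounded_smooth_domain Omega ->
  (forall y, boundary Omega y -> outward_unit_normal Omega y (nu y)) ->
  steepable Omega nu (boundary Omega).
Proof.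
move=> [_ oO _ bO sO] nuP.
have near_ x : exists V, boundary Omega x ->
    [/\ open V, V x & steepable Omega nu V].
  have [bx|bx] := pselect (boundary Omega x); last by exists setT.
  by have [V HV] := steepable_near_boundary_point oO sO nuP bx; exists V.
have [V VP] := choice near_.
have : compact (boundary Omega).
  apply: bounded_closed_compact; last exact: closed_boundary.
  have [M [Mr HM]] := bounded_closure bO.
  by exists M; split => // e Me x [cx _]; exact: HM.
rewrite compact_cover => /(_ _ (boundary Omega) V).
case=> [x /VP[]//|x bx|D sD cD]; first by exists x => //; have [] := VP _ bx.
have [Phi SPhi] : steepable Omega nu (cover [set` D] V).
  rewrite /cover bigcup_fset big_seq; elim/big_ind: _.
  - exact: steepable_set0.
  - by move=> A B; exact: steepable_setU.
  - by move=> x /sD /set_mem /VP[].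
exists Phi => B; have [L [f [f1 [f2 Hf]]]] := SPhi B.
exists L, f, f1, f2; case: Hf => ? ? ? ? ? ? Hs; split => //.
by move=> y by_ _; apply: Hs => //; exact: cD.
Qed.

(** * The maximum principle with a nonlocal flux *)

(** After division by [a `^ l], this is [1 - s `^ l <= N.+1 * (1 - s)] for
    [s = b / a] in the unit interval, which follows from Bernoulli's inequality
    because [s ^+ N.+1 <= s `^ l]. The slope is evaluated at the larger argument
    [a], so that [b = 0] is harmless even when [l < 1]. *)
Lemma powR_sub_le (R : realType) (a b l : R) (N : nat) :
  0 < l -> l <= N.+1%:R -> 0 <= b -> b <= a -> 0 < a ->
  a `^ l - b `^ l <= N.+1%:R * a `^ (l - 1) * (a - b).
Proof.
move=> l0 lN b0 ba a0; pose s := b / a.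
have s0 : 0 <= s by rewrite divr_ge0// ltW.
have s1 : s <= 1 by rewrite ler_pdivrMr// mul1r.
have -> : b = a * s by rewrite mulrCA divff ?mulr1// gt_eqF.
have al : a `^ l = a `^ (l - 1) * a.
  by rewrite -{3}(powRr1 (ltW a0)) -powRD ?subrK// (gt_eqF a0) implybT.
have bern k : 1 - s ^+ k <= k%:R * (1 - s).
  elim: k => [|k IH]; first by rewrite expr0 subrr mul0r.
  have sk : s ^+ k <= 1 by rewrite exprn_ile1.
  rewrite exprS -natr1 mulrDl mul1r.
  have : 0 <= (1 - s) * (1 - s ^+ k) by rewrite mulr_ge0// subr_ge0.
  move: IH; move: (s ^+ k) => X; nra.
have sl : s ^+ N.+1 <= s `^ l.
  move: s0; rewrite le_eqVlt => /orP[/eqP <-|s0].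
    by rewrite expr0n powR_ge0.
  by rewrite -(powR_mulrn _ (ltW s0)); apply: ger_powR => //; rewrite s0.
rewrite (powRM _ (ltW a0) s0) al [leRHS]mulrAC [leRHS]mulrC.
have -> : a `^ (l - 1) * a - a `^ (l - 1) * a * s `^ l =
  a `^ (l - 1) * (a * (1 - s `^ l)) by ring.
rewrite ler_wpM2l ?powR_ge0//.
have -> : N.+1%:R * (a - a * s) = a * (N.+1%:R * (1 - s)) by ring.
rewrite ler_wpM2l ?(ltW a0)// (le_trans _ (bern N.+1))//.
by rewrite lerD2l lerN2.
Qed.

Lemma continuous_comp_within (S T U : topologicalType) (A : set S) (B : set T)
    (h : S -> T) (f : T -> U) :
  continuous h -> (forall x, A x -> B (h x)) -> {within B, continuous f} ->
  {within A, continuous (f \o h)}.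
Proof.
move=> ch AB /subspace_continuousP cf; apply/subspace_continuousP => x Ax W fW.
have /ch := cf _ (AB _ Ax) _ fW; rewrite /nbhs/= => N.
by apply: filterS N => y /= Hy Ay; apply: Hy; exact: AB.
Qed.

Lemma continuous_line (R : realType) n (y v : 'rV[R]_n) :
  continuous (fun s : R => y - s *: v).
Proof.
move=> s.
have c1 : {for s, continuous (cst y : R -> 'rV[R]_n)} by exact: cst_continuous.
have c2 : {for s, continuous (fun s : R => s *: v)} by exact: scalel_continuous.
exact: continuousB c1 c2.
Qed.

(** The mean value theorem along the normal, inside [Omega], where the
    derivative of [f] is given by its gradient. *)
Lemma trace_gradient_ge (R : realType) n (Omega : set 'rV[R]_n)
    (f : 'rV[R]_n -> R) (g : 'rV[R]_n -> 'rV[R]_n) y v (B : R) :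
  open Omega -> {within closure Omega, continuous f} ->
  (forall i x, Omega x -> is_derive x (delta_mx ord0 i) f (g x ord0 i)) ->
  {within closure Omega, continuous g} -> closure Omega y ->
  (\forall s \near 0^'+, Omega (y - s *: v)) ->
  (\forall s \near 0^'+, f (y - s *: v) <= f y - B * s) ->
  B <= dotv (g y) v.
Proof.
move=> oO cf df /subspace_continuousP cg cy NO Nf.
rewrite leNgt; apply/negP => gB.
have cgv : dotv (g z) v @[z --> within (closure Omega) (nbhs y)] --> dotv (g y) v.
  by apply: cvg_dotv; [exact: cg|exact: cvg_cst].
have gO x i : Omega x -> {for x, continuous (fun z => g z ord0 i)}.
  move=> Ox; have cgx : {for x, continuous g}.
    have Ncl : \forall z \near x, closure Omega z.
      by apply: filterS (open_nbhs_nbhs (conj oO Ox)) => z; exact: subset_closure.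
    move=> W gW; have := cg x (subset_closure Ox) W gW.
    by apply: filterS2 Ncl => z cz; apply.
  exact: cvg_comp _ _ cgx (@coord_continuous R 1 n ord0 i (g x)).
have dfg x u : Omega x -> is_derive x u f (dotv (g x) u).
  move=> Ox; have NOx : \forall z \near x, Omega z by exact: open_nbhs_nbhs.
  have -> : g x = grad f x.
    by apply/rowP => i; rewrite mxE /partial; have [_ ->] := df i x Ox.
  apply: is_derive_grad => i.
    by apply: filterS NOx => z Oz; have [] := df i z Oz.
  have E : {near x, (fun z => g z ord0 i) =1 partial i f}.
    by apply: filterS NOx => z Oz; have [_ <-] := df i z Oz.
  rewrite /prop_for/continuous_at -(nbhs_singleton E).
  exact: cvg_trans (near_eq_cvg E) (gO x i Ox).
have Ng : \forall s \near (0 : R)^'+, closure Omega (y - s *: v) ->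
    dotv (g (y - s *: v)) v < B.
  have := cvgr_lt _ cgv _ gB; rewrite near_withinE => /(_ _) N.
  have N2 := near_line (- v) N.
  by apply: filterS N2 => s; rewrite scalerN.
have : \forall s \near (0 : R)^'+, [/\ Omega (y - s *: v),
    dotv (g (y - s *: v)) v < B & f (y - s *: v) <= f y - B * s].
  near=> s; have Os : Omega (y - s *: v) by near: s.
  split => //; last by near: s.
  have : closure Omega (y - s *: v) by exact: subset_closure.
  by near: s.
rewrite near_withinE => /nbhs_ballP[d /= d0 Hd].
have Hs s : 0 < s -> s < d -> [/\ Omega (y - s *: v),
    dotv (g (y - s *: v)) v < B & f (y - s *: v) <= f y - B * s].
  by move=> s0 sd; apply: Hd => //; rewrite -ball_normE/= sub0r normrN gtr0_norm.
pose s := d / 2.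
have s0 : 0 < s by rewrite divr_gt0.
have sd : s < d by rewrite ltr_pdivrMr// ltr_pMr ?ltr1n.
have [||r] := @MVT R (fun r => f (y - r *: v)) (fun r => - dotv (g (y - r *: v)) v)
  0 s s0.
- move=> r; rewrite in_itv/= => /andP[r0 rs].
  have [Or _ _] := Hs r r0 (lt_trans rs sd).
  rewrite -dotvNr (_ : (fun r => _) = fun z => f (y + z *: - v)); last first.
    by apply/funext => z; rewrite scalerN.
  by apply/is_derive_line; rewrite scalerN; exact: dfg.
- apply: (@continuous_comp_within _ _ _ _ (closure Omega)) => //.
    exact: continuous_line.
  move=> r /=; rewrite in_itv/= => /andP[]; rewrite le_eqVlt => /orP[/eqP <- _|r0 rs].
    by rewrite scale0r subr0.
  apply: subset_closure.
  by have [] := Hs r r0 (le_lt_trans rs sd).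
rewrite in_itv/= => /andP[r0 rs] E.
have [_ gr _] := Hs r r0 (lt_trans rs sd).
have [_ _ fs] := Hs s s0 sd.
move: E; rewrite scale0r !subr0 => E.
have : f (y - s *: v) - f y <= - (B * s) by rewrite lerBlDl.
rewrite E mulNr lerN2 ler_pM2r// leNgt => /negP; exact.
Unshelve. all: by end_near.
Qed.

Lemma continuous_pairl (S T : topologicalType) (b : T) :
  continuous (fun a : S => (a, b)).
Proof. by move=> a; apply: cvg_pair; [exact: cvg_id|exact: cvg_cst]. Qed.

Lemma continuous_pairr (S T : topologicalType) (a : S) :
  continuous (fun b : T => (a, b)).
Proof. by move=> b; apply: cvg_pair; [exact: cvg_cst|exact: cvg_id]. Qed.

Lemma normal_points_inward (R : realType) n (Omega : set 'rV[R]_n) nu y :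
  open Omega -> smooth_boundary Omega -> boundary Omega y ->
  outward_unit_normal Omega y nu ->
  \forall s \near 0^'+, Omega (y - s *: nu).
Proof.
move=> oO sO by_ nuP; have [U [rho H]] := sO _ by_.
have Uy := ldf_mem H.
have g0 : 0 < enorm (grad rho y).
  by rewrite sqrtr_gt0 dotv_gt0// (ldf_regular H).
have gv : dotv (grad rho y) (- nu) < 0.
  rewrite dotvNr oppr_lt0 (lt_le_trans g0)//.
  exact: enorm_grad_le_normal oO H Uy by_ nuP.
by apply: filterS (ldf_inward oO H Uy by_ gv) => s; rewrite scalerN.
Qed.

(** The flux condition is nonlocal in that it bounds the normal derivative at one
    point by the values of [w] at all points at the same time. A barrier [psi]
    steeper at the boundary than [K] times a bound on its values absorbs it. *)
Lemma nonlocal_flux_maximum_principle (R : realType) n (Omega : set 'rV[R]_n)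
    (nu : 'rV[R]_n -> 'rV[R]_n) (t K : R)
    (w wt : 'rV[R]_n -> R -> R) (w2 : 'I_n -> 'rV[R]_n -> R -> R)
    (g : 'rV[R]_n -> R -> 'rV[R]_n) :
  bounded_smooth_domain Omega ->
  (forall y, boundary Omega y -> outward_unit_normal Omega y (nu y)) ->
  0 <= K ->
  {within closure Omega `*` `[0, t], continuous (fun z => w z.1 z.2)} ->
  (forall s, 0 <= s <= t -> {within closure Omega, continuous (g ^~ s)}) ->
  (forall i x s, Omega x -> 0 < s <= t ->
    is_derive x (delta_mx ord0 i) (w ^~ s) (g x s ord0 i)) ->
  (forall i x s, Omega x -> 0 < s <= t ->
    is_derive x (delta_mx ord0 i) (fun y => g y s ord0 i) (w2 i x s)) ->
  (forall x s, Omega x -> 0 < s <= t -> is_derive s 1 (w x) (wt x s)) ->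
  (forall x s, Omega x -> 0 < s <= t -> 0 < w x s ->
    wt x s <= \sum_(i < n) w2 i x s) ->
  (forall x s m, boundary Omega x -> 0 < s <= t -> 0 <= m ->
    (forall y, Omega y -> w y s <= m) -> dotv (g x s) (nu x) <= K * m) ->
  (forall x, closure Omega x -> w x 0 <= 0) ->
  forall x s, closure Omega x -> 0 <= s <= t -> w x s <= 0.
Proof.
move=> dO nuP K0 cw cg dw dw2 dwt pde flux init x s cx s0t.
have [_ oO _ bO sO] := dO.
have [Phi SPhi] := steepable_boundary dO nuP.
have Phi0 : 0 <= Phi.
  have [L0 [phi0 [? [? Hphi0]]]] := SPhi 0.
  by have /andP[] := bb_range Hphi0 cx; exact: le_trans.
(* [Phi + 1] bounds the barrier [psi] below, which does not depend on [B]. *)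
pose B := K * (Phi + 1) + 1.
have [L [phi [phi1 [phi2 Hphi]]]] := SPhi B.
(* Adding 1 allows dividing by the barrier. *)
pose psi y := phi y + 1.
have psi1 y : closure Omega y -> 1 <= psi y.
  by move=> cy; have /andP[p0 _] := bb_range Hphi cy; rewrite lerDr.
have psi_le y : closure Omega y -> psi y <= Phi + 1.
  by move=> cy; have /andP[_ p0] := bb_range Hphi cy; rewrite lerD2r.
have psi0 y : closure Omega y -> 0 < psi y.
  by move=> /psi1; apply: lt_le_trans.
pose lam := `|L| + 1.
have lamL : L < lam by rewrite (le_lt_trans (ler_norm _))// ltrDl.
have lam0 : 0 <= lam by rewrite addr_ge0.
pose C := closure Omega `*` `[0, t]%classic.
have compC : compact C.
  apply: compact_setX; last exact: segment_compact.
  by apply: bounded_closed_compact; [exact: bounded_closure|exact: closed_closure].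
pose z (p : 'rV[R]_n * R) := w p.1 p.2 / (expR (lam * p.2) * psi p.1).
have cz : {within C, continuous z}.
  have cpsi : {within C, continuous (psi \o fst)}.
    apply: (@continuous_comp_within _ _ _ C (closure Omega) fst psi).
    - by move=> p; exact: cvg_fst.
    - by move=> p [].
    - move=> y; apply: (@continuousD _ _ (subspace (closure Omega))).
        exact: (bb_continuous Hphi).
      exact: cst_continuous.
  have cexp : {within C, continuous (fun p : 'rV[R]_n * R => expR (lam * p.2))}.
    apply: continuous_subspaceT => p.
    apply: (@continuous_comp _ _ _ (fun p : 'rV[R]_n * R => lam * p.2) expR).
      by apply: cvgMr; exact: cvg_snd.
    exact: continuous_expR.
  have cden : {within C, continuous (fun p => expR (lam * p.2) * psi p.1)}.
    move=> p; exact: (@continuousM _ (subspace C) _ _ p (cexp p) (cpsi p)).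
  apply/subspace_continuousP => p Cp.
  move/subspace_continuousP : cden => /(_ p Cp) cden.
  move/subspace_continuousP : cw => /(_ p Cp) cw.
  apply: cvgM => //; apply: cvgV => //.
  by rewrite gt_eqF// mulr_gt0 ?expR_gt0// psi0//; case: Cp.
have Cxs : C (x, s) by split => //=; rewrite in_itv.
have [[x0 s0] /set_mem Cm zmax] := compact_EVT_max (ex_intro _ _ Cxs) compC cz.
set m := z (x0, s0) in zmax.
have {zmax} wle y r : closure Omega y -> 0 <= r <= t ->
    w y r <= m * expR (lam * r) * psi y.
  move=> cy rt; have /zmax : (y, r) \in C.
    by apply/mem_set; split => //=; rewrite in_itv.
  by rewrite /z/= ler_pdivrMr ?mulrA// mulr_gt0 ?expR_gt0// psi0.
have [m0|m0] := leP m 0.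
  rewrite (le_trans (wle _ _ cx s0t))// -mulrA mulr_le0_ge0//.
  by rewrite mulr_ge0 ?expR_ge0// ltW// psi0.
exfalso.
have [/= cx0] := Cm; rewrite in_itv/= => /andP[s0_ge0 s0_le].
have s0rng : 0 <= s0 <= t by rewrite s0_ge0.
set e := expR (lam * s0).
have e0 : 0 < e by exact: expR_gt0.
have me0 : 0 < m * e by rewrite mulr_gt0.
have weq : w x0 s0 = m * e * psi x0.
  by rewrite /m /z/= -mulrA divfK// gt_eqF// mulr_gt0// psi0.
have w0 : 0 < w x0 s0 by rewrite weq mulr_gt0// psi0.
have s0_gt0 : 0 < s0.
  rewrite lt_def s0_ge0 andbT; apply: contraTneq w0 => ->.
  by rewrite -leNgt init.
have s0t' : 0 < s0 <= t by rewrite s0_gt0.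
(* The barrier touches [w] from above at [(x0, s0)]. *)
have [Ox0|nOx0] := pselect (Omega x0).
- have time : lam * (m * e * psi x0) <= wt x0 s0.
    pose W r := m * psi x0 * expR (lam * r).
    have dexp : is_derive s0 1 (fun r => expR (lam * r)) (e * lam).
      apply: (is_derive1_comp (is_derive_expR _)).
      apply: is_derive_eq (is_deriveZ lam (is_derive_id s0 1)) _.
      by rewrite [_ *: 1]mulr1.
    have dW := is_deriveZ (m * psi x0) dexp.
    have := @derive_at_left_max R _ s0 _ (is_deriveB (dwt _ _ Ox0 s0t') dW).
    rewrite subr_ge0 => H.
    have -> : lam * (m * e * psi x0) = (m * psi x0) *: (e * lam) :> R.
      by change (lam * (m * e * psi x0) = m * psi x0 * (e * lam)); ring.
    apply: H; near=> r.
    have r0 : 0 < r by near: r; exact: nbhs_left_gt.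
    have rs0 : r < s0 by near: r; exact: nbhs_left_lt.
    have rt : 0 <= r <= t by rewrite (ltW r0) (le_trans (ltW rs0)).
    change (w x0 r - m * psi x0 * expR (lam * r) <=
      w x0 s0 - m * psi x0 * expR (lam * s0)).
    rewrite weq (mulrAC m e) subrr subr_le0 (mulrAC m); exact: wle.
  have space i : w2 i x0 s0 <= m * e * phi2 i x0.
    pose dir : 'rV[R]_n := delta_mx ord0 i.
    have NO : \forall r \near (0 : R), Omega (x0 + r *: dir).
      have cl : {for (0 : R), continuous (fun r : R => x0 - r *: - dir)}.
        exact: continuous_line.
      have := cl Omega; rewrite scale0r subr0 => /(_ (open_nbhs_nbhs (conj oO Ox0))).
      move=> NN; have {}NN : \forall r \near (0 : R), Omega (x0 - r *: - dir) := NN.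
      by apply: filterS NN => r; rewrite scalerN opprK.
    rewrite -subr_le0.
    have E0 : x0 + (0 : R) *: dir = x0 by rewrite scale0r addr0.
    apply: (@second_derivative_at_max R
      (fun r => w (x0 + r *: dir) s0 - m * e * phi (x0 + r *: dir))
      (fun r => g (x0 + r *: dir) s0 ord0 i - m * e * phi1 i (x0 + r *: dir))).
    + apply: filterS NO => r Or.
      have D1 := (is_derive_line (w ^~ s0) _ _ _ _).1 (dw i _ s0 Or s0t').
      have D2 := (is_derive_line phi _ _ _ _).1 (bb_derive Hphi i Or).
      exact: is_deriveB D1 (is_deriveZ (m * e) D2).
    + have D1 := dw2 i _ s0 Ox0 s0t'; have D2 := bb_derive2 Hphi i Ox0.
      rewrite -E0 in D1 D2.
      have {}D1 := (is_derive_line (fun y => g y s0 ord0 i) _ _ _ _).1 D1.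
      have {}D2 := (is_derive_line (phi1 i) _ _ _ _).1 D2.
      rewrite E0 in D1 D2.
      exact: is_deriveB D1 (is_deriveZ (m * e) D2).
    + apply: filterS NO => r Or; rewrite E0 weq.
      have := wle _ _ (subset_closure Or) s0rng.
      rewrite -/e /psi !mulrDr !mulr1; lra.
  have := pde _ _ Ox0 s0t' w0; apply/negP; rewrite -ltNge.
  apply: lt_le_trans time.
  apply: (@le_lt_trans _ _ (m * e * L)).
    rewrite (le_trans (ler_sum _ (fun i _ => space i)))// -mulr_sumr ler_pM2l//.
    exact: (bb_laplacian Hphi).
  rewrite mulrCA ltr_pM2l// (lt_le_trans lamL)// ler_peMr// psi1//.
- have bx0 : boundary Omega x0.
    by split => //; rewrite (interior_id _).1.
  have NO := normal_points_inward oO sO bx0 (nuP _ bx0).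
  have cws0 : {within closure Omega, continuous (w ^~ s0)}.
    apply: (@continuous_comp_within _ _ _ _ C (fun y => (y, s0))
      (fun z => w z.1 z.2) _ _ cw).
      exact: continuous_pairl.
    by move=> y cy; split => //=; rewrite in_itv.
  have lower : m * e * B <= dotv (g x0 s0) (nu x0).
    apply: (@trace_gradient_ge R n Omega (w ^~ s0) (g ^~ s0)) => //.
    + by move=> i y Oy; exact: dw.
    + exact: cg.
    + move: (bb_steep Hphi bx0 bx0); apply: filterS2 NO => r Or pr.
      rewrite (le_trans (wle _ _ (subset_closure Or) s0rng))// -/e weq.
      rewrite -(mulrA (m * e) B) -mulrBr.
      by rewrite ler_pM2l// /psi addrAC lerD2r.
  have upper : dotv (g x0 s0) (nu x0) <= K * (m * e * (Phi + 1)).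
    apply: flux => //; first by rewrite mulr_ge0 ?addr_ge0// ltW.
    move=> y Oy; have cy := subset_closure Oy.
    by rewrite (le_trans (wle _ _ cy s0rng))// ler_pM2l// psi_le.
  have := le_trans lower upper; rewrite mulrCA ler_pM2l// /B.
  by rewrite -subr_ge0 opprD addrA subrr sub0r oppr_ge0 ler10.
Unshelve. all: by end_near.
Qed.

(** * Comparison of subsolutions and supersolutions *)

Lemma compact_norm_bound (R : realType) (S : topologicalType) (A : set S)
    (f : S -> R) :
  compact A -> {within A, continuous f} ->
  exists2 M, 0 <= M & forall x, A x -> `|f x| <= M.
Proof.
move=> cA cf; have [M [Mr HM]] := compact_bounded (continuous_compact cf cA).
exists (`|M| + 1); first by rewrite addr_ge0.
move=> x Ax; apply: (HM (`|M| + 1)); last by exists x.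
by rewrite (le_lt_trans (ler_norm _))// ltrDl.
Qed.

Lemma closure_le0 (R : realType) (S : topologicalType) (A : set S) (f : S -> R) :
  {within closure A, continuous f} -> (forall x, A x -> f x <= 0) ->
  forall x, closure A x -> f x <= 0.
Proof.
move=> /subspace_continuousP cf f0 x cx; rewrite leNgt; apply/negP => fx.
have := cvgr_gt _ (cf _ cx) _ fx; rewrite near_withinE => /(_ _) N.
have [y [Ay /(_ (subset_closure Ay))]] := cx _ N.
by rewrite ltNge f0.
Qed.

(** The power [a `^ (l - 1)] is monotone in [a], in a direction given by the sign
    of [l - 1]; the sum of the two extreme values covers both cases. *)
Lemma powR_slope_bound (R : realType) (a m M d l : R) :
  0 < m -> m <= a -> a <= M -> (l < 1 -> d <= a) -> 0 < d ->
  a `^ (l - 1) <= M `^ (l - 1) + d `^ (l - 1).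
Proof.
move=> m0 ma aM da d0; have a0 := lt_le_trans m0 ma.
have [l1|l1] := ltP l 1.
  apply: le_trans (_ : d `^ (l - 1) <= _); last by rewrite lerDr powR_ge0.
  rewrite -(opprB 1 l) !powRN lef_pV2 ?posrE ?powR_gt0//.
  apply: ge0_ler_powR; rewrite ?nnegrE ?subr_ge0 ?(ltW l1) ?(ltW d0) ?(ltW a0)//.
  exact: da.
apply: le_trans (_ : M `^ (l - 1) <= _); last by rewrite lerDl powR_ge0.
by apply: ge0_ler_powR; rewrite ?nnegrE ?subr_ge0 ?(ltW a0)//
  (le_trans (ltW a0)).
Qed.

Lemma parabolic_domainP (R : realType) n (Omega : set 'rV[R]_n) (T : R) x s :
  0 < T ->
  (Q_ Omega T `|` Gamma_ Omega T) (x, s) <-> closure Omega x /\ 0 <= s < T.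
Proof.
move=> T0; split.
  move=> [[/= Ox]|[[/= [cx _]]|[/= cx ->]]].
  - rewrite in_itv/= => /andP[s0 ->]; rewrite (ltW s0).
    by split => //; exact: subset_closure.
  - by rewrite in_itv/= => /andP[s0 ->]; rewrite (ltW s0).
  - by rewrite lexx.
move=> [cx /andP[]]; rewrite le_eqVlt => /orP[/eqP<- _|s0 sT].
  by right; right.
have sT' : `]0, T[%classic s by rewrite /= in_itv/= s0.
have [Ox|Ox] := pselect (Omega° x); first by left; split => //;
  exact: interior_subset Ox.
by right; left.
Qed.

Section slices.
Context {R : realType} {n : nat}.
Variables (Omega : set 'rV[R]_n) (T : R).
Hypotheses (oOmega : open Omega) (T_gt0 : 0 < T).

Lemma continuous_slice (V : topologicalType) (f : 'rV[R]_n * R -> V) s :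
  {within Q_ Omega T `|` Gamma_ Omega T, continuous f} -> 0 <= s < T ->
  {within closure Omega, continuous (fun x => f (x, s))}.
Proof.
move=> cf sT; apply: (continuous_comp_within (h := fun x => (x, s)) _ _ cf).
  exact: continuous_pairl.
by move=> x cx; apply/parabolic_domainP.
Qed.

Lemma continuous_until (V : topologicalType) (f : 'rV[R]_n * R -> V) t :
  {within Q_ Omega T `|` Gamma_ Omega T, continuous f} -> t < T ->
  {within closure Omega `*` `[0, t], continuous f}.
Proof.
move=> cf tT; apply: continuous_subspaceW cf => -[x s] [/= cx].
rewrite in_itv/= => /andP[s0 st]; apply/parabolic_domainP => //.
by split => //; rewrite s0 (le_lt_trans st).
Qed.

End slices.

Theorem theorem3p1 (R : realType) (n : nat) (n_ge1 : (1 <= n)%N)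
  (Omega : set 'rV[R]_n) (Omega_domain : bounded_smooth_domain Omega)
  (nu : 'rV[R]_n -> 'rV[R]_n)
  (nu_normal : forall x, boundary Omega x -> outward_unit_normal Omega x (nu x))
  (p l : R) (p_gt0 : 0 < p) (l_gt0 : 0 < l)
  (alpha : R) (alpha_itv : 0 < alpha < 1)
  (c : 'rV[R]_n -> R -> R)
  (c_holder : locally_holder alpha (closure Omega `*` [set t : R | 0 <= t])
                (fun z : 'rV[R]_n * R => c z.1 z.2))
  (c_ge0 : forall x (t : R), closure Omega x -> 0 <= t -> 0 <= c x t)
  (k : 'rV[R]_n -> 'rV[R]_n -> R -> R)
  (k_continuous :
    {within boundary Omega `*` (closure Omega `*` [set t : R | 0 <= t]),
      continuous (fun z : 'rV[R]_n * ('rV[R]_n * R) => k z.1 z.2.1 z.2.2)})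
  (k_ge0 : forall x y (t : R), boundary Omega x -> closure Omega y -> 0 <= t ->
    0 <= k x y t)
  (u0 : 'rV[R]_n -> R)
  (u0_C1 : C1_closure Omega u0)
  (u0_ge0 : forall x, Omega x -> 0 <= u0 x)
  (u0_boundary : forall x, boundary Omega x ->
    normal_derivative Omega (nu x) u0 x =
    \int[lebesgue_rV n]_(y in Omega) (k x y 0 * u0 y `^ l))
  (T : R) (T_gt0 : 0 < T)
  (u_up u_low : 'rV[R]_n -> R -> R)
  (u_up_super : supersolution Omega nu p l c k u0 T u_up)
  (u_low_sub : subsolution Omega nu p l c k u0 T u_low)
  (positivity : l < 1 ->
    (forall x t, (Q_ Omega T `|` Gamma_ Omega T) (x, t) -> 0 < u_low x t) \/
    (forall x t, (Q_ Omega T `|` Gamma_ Omega T) (x, t) -> 0 < u_up x t)) :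
  forall x t, (Q_ Omega T `|` Gamma_ Omega T) (x, t) -> u_low x t <= u_up x t.
Proof.
move=> x t /parabolic_domainP; move/(_ T_gt0) => [cx /andP[t0 tT]].
have [_ oO _ bO _] := Omega_domain.
have [ul0 [_ dtl _ _ _ d2l _] [cl dl [gl cgl glE]] eql bdl inl] := u_low_sub.
have [uu0 [_ dtu _ _ _ d2u _] [cu du [gu cgu guE]] equ bdu inu] := u_up_super.
have inT s : 0 <= s <= t -> 0 <= s < T.
  by move=> /andP[-> st]; rewrite (le_lt_trans st).
have inQ y s : Omega y -> 0 < s <= t -> Q_ Omega T (y, s).
  by move=> Oy /andP[s0 st]; split => //=; rewrite in_itv/= s0 (le_lt_trans st).
have inQG y s : closure Omega y -> 0 <= s <= t ->
    (Q_ Omega T `|` Gamma_ Omega T) (y, s).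
  by move=> cy st; apply/parabolic_domainP => //; split => //; exact: inT.
have ge0le s : 0 < s <= t -> 0 <= s <= t by move=> /andP[/ltW -> ->].
have mO : measurable Omega by exact: open_measurable_rV.
have Ofin := lebesgue_rV_bounded_fin mO bO.
have cclO : compact (closure Omega).
  by apply: bounded_closed_compact; [exact: bounded_closure|exact: closed_closure].
(* Stopping at [t < T] makes the cylinder compact, with the equations still
   valid on its top. *)
pose C := closure Omega `*` `[0, t]%classic.
have cC : compact C by apply: compact_setX => //; exact: segment_compact.
have Cxt : C (x, t) by split => //=; rewrite in_itv/= t0 lexx.
have CE y s : C (y, s) <-> closure Omega y /\ 0 <= s <= t.
  split=> [[/= cy]|[cy st]]; first by rewrite in_itv.
  by split => //=; rewrite in_itv.
have clC := continuous_until T_gt0 cl tT.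
have cuC := continuous_until T_gt0 cu tT.
have [M M0 ulM] := compact_norm_bound cC clC.
(* Only values of [u_low] above [u_up] enter the slope of [r `^ l], so that the
   positivity of either function keeps them away from 0. *)
have [d d0 ud] : exists2 d, 0 < d & l < 1 -> forall y s, C (y, s) ->
    u_up y s < u_low y s -> d <= u_low y s.
  have [l1|l1] := ltP l 1; last by exists 1.
  have pos_min (u : 'rV[R]_n -> R -> R) :
      {within C, continuous (fun z => u z.1 z.2)} ->
      (forall y s, (Q_ Omega T `|` Gamma_ Omega T) (y, s) -> 0 < u y s) ->
      exists2 d : R, 0 < d & forall y s, C (y, s) -> d <= u y s.
    move=> cuu up; have [[y0 s0] /set_mem Cm umin] :=
      compact_EVT_min (ex_intro _ _ Cxt) cC cuu.
    exists (u y0 s0); first by apply: up; case/CE : Cm; exact: inQG.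
    by move=> y s ys; apply: (umin (y, s)); exact: mem_set.
  have [P|P] := positivity l1.
    by have [d d0 dP] := pos_min _ clC P; exists d => // _ y s ys _; exact: dP.
  have [d d0 dP] := pos_min _ cuC P; exists d => // _ y s ys /ltW.
  exact: le_trans (dP _ _ ys).
have [Kk Kk0 kK] : exists2 Kk, 0 <= Kk & forall z y s, boundary Omega z ->
    closure Omega y -> 0 <= s <= t -> `|k z y s| <= Kk.
  have cD : compact (boundary Omega `*` C).
    apply: compact_setX => //; apply: subclosed_compact cclO _.
      exact: closed_boundary.
    by move=> z [].
  have ckD : {within boundary Omega `*` C, continuous
      (fun z : 'rV[R]_n * ('rV[R]_n * R) => k z.1 z.2.1 z.2.2)}.
    apply: continuous_subspaceW k_continuous => -[z [y s]] [/= bz [/= cy]].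
    by rewrite in_itv/= => /andP[s0 _].
  have [Kk Kk0 HK] := compact_norm_bound cD ckD; exists Kk => // z y s bz cy st.
  by apply: (HK (z, (y, s))); split => //; apply/CE.
have [N lN] : exists N : nat, l <= N.+1%:R.
  exists (Num.trunc l); apply: ltW; have := truncnS_gt l; exact.
pose L := N.+1%:R * (M `^ (l - 1) + d `^ (l - 1)).
have L0 : 0 <= L by rewrite mulr_ge0// addr_ge0// powR_ge0.
have lip y s m : closure Omega y -> 0 <= s <= t -> 0 <= m ->
    u_low y s - u_up y s <= m -> u_low y s `^ l <= u_up y s `^ l + L * m.
  move=> cy st m0 wm; have ys := inQG y s cy st.
  have [lu|ul] := leP (u_low y s) (u_up y s).
    apply: le_trans (_ : u_up y s `^ l <= _); last by rewrite lerDl mulr_ge0.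
    by apply: ge0_ler_powR; rewrite ?nnegrE ?(ltW l_gt0)// ?ul0 ?uu0.
  have l0 : 0 < u_low y s by rewrite (le_lt_trans _ ul)// uu0.
  have := powR_sub_le l_gt0 lN (uu0 _ _ ys) (ltW ul) l0.
  rewrite lerBlDl => /le_trans; apply; rewrite lerD2l.
  apply: ler_pM => //; rewrite ?mulr_ge0 ?powR_ge0 ?subr_ge0 ?(ltW ul)//.
  rewrite ler_wpM2l// (powR_slope_bound l0)//.
    by rewrite (le_trans (ler_norm _))// (ulM (y, s))//; apply/CE.
  by move=> l1; apply: ud => //; apply/CE.
pose mu := fine (lebesgue_rV n Omega).
have mu0 : 0 <= mu by exact: fine_ge0.
rewrite -subr_le0.
apply: (@nonlocal_flux_maximum_principle R n Omega nu t (Kk * L * mu)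
  (fun y s => u_low y s - u_up y s)
  (fun y s => derive1 (u_low y) s - derive1 (u_up y) s)
  (fun i y s => partial i (partial i (u_low ^~ s)) y -
    partial i (partial i (u_up ^~ s)) y)
  (fun y s => gl (y, s) - gu (y, s))) => //; last by rewrite t0 lexx.
- by apply: mulr_ge0 => //; exact: mulr_ge0.
- move=> z; exact: (@continuousB _ _ (subspace C)) (clC z) (cuC z).
- move=> s st z; have sT := inT s st.
  have c1 := continuous_slice T_gt0 cgl sT.
  have c2 := continuous_slice T_gt0 cgu sT.
  exact: (@continuousB _ _ (subspace (closure Omega))) (c1 z) (c2 z).
- move=> i y s Oy st; have sT := inT s (ge0le s st).
  have D1 := derivableP (dl i y s Oy sT); have D2 := derivableP (du i y s Oy sT).
  by rewrite glE// guE// !mxE; exact: is_deriveB D1 D2.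
- move=> i y s Oy st; have sT := inT s (ge0le s st).
  have D1 := derivableP (d2l i i y s (inQ y s Oy st)).
  have D2 := derivableP (d2u i i y s (inQ y s Oy st)).
  apply: near_eq_is_derive (is_deriveB D1 D2).
  apply: filterS (open_nbhs_nbhs (conj oO Oy)) => z Oz.
  by rewrite glE// guE// !mxE.
- move=> y s Oy st; have Q := inQ y s Oy st; rewrite !derive1E.
  exact: is_deriveB (derivableP (dtl y s Q)) (derivableP (dtu y s Q)).
- move=> y s Oy st; rewrite subr_gt0 => wpos; have Q := inQ y s Oy st.
  have G : (Q_ Omega T `|` Gamma_ Omega T) (y, s) by left.
  have e1 := eql _ _ Q; have e2 := equ _ _ Q.
  have cpos : c y s * u_up y s `^ p <= c y s * u_low y s `^ p.
    apply: ler_wpM2l.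
      by apply: c_ge0; [exact: subset_closure|case/andP: (ge0le s st)].
    by apply: ge0_ler_powR; rewrite ?nnegrE ?(ltW p_gt0) ?ul0 ?uu0 ?(ltW wpos).
  rewrite sumrB; move: e1 e2; rewrite /laplacian; lra.
- move=> z s m bz st m0 wm; have st' := ge0le s st; have sT := inT s st'.
  have cz : closure Omega z by case: bz.
  have N1 := bdl z s bz sT; have N2 := bdu z s bz sT.
  rewrite /normal_derivative in N1 N2.
  rewrite (trace_gradE (continuous_slice T_gt0 cgl sT)) // in N1; last first.
    by move=> y Oy; exact: glE.
  rewrite (trace_gradE (continuous_slice T_gt0 cgu sT)) // in N2; last first.
    by move=> y Oy; exact: guE.
  have meas_bound (u : 'rV[R]_n -> R -> R) : {within Q_ Omega T `|` Gamma_ Omega T,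
      continuous (fun q => u q.1 q.2)} ->
      (forall y s, (Q_ Omega T `|` Gamma_ Omega T) (y, s) -> 0 <= u y s) ->
      measurable_fun Omega (fun y => k z y s * u y s `^ l) /\
      [bounded (k z y s * u y s `^ l) | y in Omega].
    move=> cuu u0'; have cus := continuous_slice T_gt0 cuu sT.
    split.
      have mk : measurable_fun Omega (fun y => k z y s).
        apply: within_continuous_measurable_rV => //.
        apply: (@continuous_comp_within _ _ _ _ _
          (fun y : 'rV[R]_n => (z, (y, s))) _ _ _ k_continuous).
          by move=> y; exact: (continuous_comp (@continuous_pairl _ _ s y)
            (@continuous_pairr _ _ z _)).
        move=> y Oy; split => //=; split; first exact: subset_closure.
        by case/andP: st'.
      apply: measurable_funM => //.
      have mus : measurable_fun Omega (fun y => u y s).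
        apply: within_continuous_measurable_rV => //.
        exact: continuous_subspaceW (@subset_closure _ _) cus.
      exact: (measurableT_comp (measurable_powR l) mus).
    have [Mu Mu0 HMu] := compact_norm_bound cclO cus.
    exists (Kk * Mu `^ l); split; first exact: num_real.
    move=> b Mb y Oy; apply: le_trans (ltW Mb); have cy := subset_closure Oy.
    rewrite /= normrM (ger0_norm (powR_ge0 _ _)).
    apply: ler_pM => //; [exact: powR_ge0|exact: kK|].
    have uy : 0 <= u y s by apply: u0'; exact: inQG.
    apply: ge0_ler_powR; rewrite ?nnegrE ?(ltW l_gt0)//.
    by rewrite (le_trans (ler_norm _))// HMu.
  have [m1 b1] := meas_bound _ cl ul0; have [m2 b2] := meas_bound _ cu uu0.
  have := @Rintegral_leDr _ _ R (lebesgue_rV n) Omega _ _ (Kk * (L * m)) mO Ofin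
    m1 b1 m2 b2.
  rewrite -/mu => /(_ _) I.
  rewrite dotvDl dotvNl.
  have -> : Kk * L * mu * m = Kk * (L * m) * mu by ring.
  rewrite lerBlDl (le_trans N1)// (le_trans (I _))//; last by rewrite lerD2r.
  move=> y Oy; have cy := subset_closure Oy.
  have k0 : 0 <= k z y s by apply: k_ge0 => //; case/andP: st'.
  have km : k z y s <= Kk by rewrite (le_trans (ler_norm _))// kK.
  apply: le_trans (ler_wpM2l k0 (lip y s m cy st' m0 (wm y Oy))) _.
  by rewrite mulrDr lerD2l ler_wpM2r// mulr_ge0.
- have t0t : 0 <= (0 : R) <= t by rewrite lexx.
  have s0 := inT 0 t0t.
  have c0 : {within closure Omega, continuous (fun y => u_low y 0 - u_up y 0)}.
    have c1 : {within closure Omega, continuous (u_low ^~ 0)}.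
      exact: (continuous_slice T_gt0 cl s0).
    have c2 : {within closure Omega, continuous (u_up ^~ 0)}.
      exact: (continuous_slice T_gt0 cu s0).
    move=> y; exact: (@continuousB _ _ (subspace (closure Omega))) (c1 y) (c2 y).
  apply: closure_le0 c0 _ => y Oy.
  by rewrite subr_le0 (le_trans (inl y Oy))// inu.
Qed.
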